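(* Let $\mathcal{U}$ be an ultrafilter on a complete Boolean algebra $\mathcal{B}$, $T$ a complete countable first-order theory, and $\lambda$ an infinite cardinal. The following are equivalent: (A) $\mathcal{U}$ $\lambda^+$-saturates $T$; (B) every $(\lambda,T)$-Łoś map in $\mathcal{U}$ has a multiplicative refinement in $\mathcal{U}$; (C) every $(\lambda,T)$-Łoś map of arity $1$ in $\mathcal{U}$ has a multiplicative refinement in $\mathcal{U}$.
   Context: Full $\mathcal{B}$-valued structure: a set $\mathbf{M}$ with $\|\cdot\|_{\mathbf{M}}$ from formulas with parameters in $\mathbf{M}$ to $\mathcal{B}$, with valid sentences $\mapsto1$, $\|\neg\varphi\|=\neg\|\varphi\|$, $\|\varphi\wedge\psi\|=\|\varphi\|\wedge\|\psi\|$, $\|\exists x\varphi(x)\|=\bigvee_a\|\varphi(a)\|$, $\|a=b\|<1$ for distinct $a,b$, and for each $\varphi(x)$ some $a$ attaining $\|\exists x\varphi(x)\|=\|\varphi(a)\|$. $\mathbf{M}\models^{\mathcal{B}}T$: full and $\|\varphi\|=1$ for $\varphi\in T$. Elementary maps $f:\mathbf{M}\preceq\mathbf{N}$ preserve all values $\|\cdot\|$. $\mathbf{M}\models^{\mathcal{B}}T$ is $\lambda^+$-saturated if for all $\mathbf{M}_0\preceq\mathbf{N}_0\models^{\mathcal{B}}T$ with $|\mathbf{N}_0|\le\lambda$, every elementary $f:\mathbf{M}_0\preceq\mathbf{M}$ extends to an elementary $g:\mathbf{N}_0\preceq\mathbf{M}$. The specialization $\mathbf{M}/\mathcal{U}$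 is the ordinary structure with a surjection $[\cdot]_{\mathcal{U}}$ from $\mathbf{M}$ such that $\|\varphi(\overline{a})\|\in\mathcal{U}$ iff $\mathbf{M}/\mathcal{U}\models\varphi([\overline{a}]_{\mathcal{U}})$. $\mathcal{U}$ $\lambda^+$-saturates $T$ means: every $\lambda^+$-saturated $\mathbf{M}\models^{\mathcal{B}}T$ has $\mathbf{M}/\mathcal{U}$ $\lambda^+$-saturated. A $\lambda$-distribution in $\mathcal{B}$ is $\mathbf{A}:[\lambda]^{<\aleph_0}\to\mathcal{B}\setminus\{0\}$ with $\mathbf{A}(\emptyset)=1$ and $\mathbf{A}$ decreasing under inclusion; it is in $\mathcal{U}$ if its image is in $\mathcal{U}$; multiplicative if $\mathbf{A}(s)=\bigwedge_{i\in s}\mathbf{A}(\{i\})$; $\mathbf{B}$ refines $\mathbf{A}$ if $\mathbf{B}(s)\le\mathbf{A}(s)$ for all $s$. $\mathbf{A}$ is a $(\lambda,T)$-Łoś map if there are formulas $\varphi_i(\overline{x},\overline{y}_i)$ ($i<\lambda$; $\overline{y}_i$ pairwise disjoint and disjoint from $\overline{x}$), some $\mathbf{M}\models^{\mathcal{B}}T$ and tuples $\overline{a}_i\in\mathbf{M}$ with $\mathbf{A}(s)=\|\exists\overline{x}\bigwedge_{i\in s}\varphi_i(\overline{x},\overline{a}_i)\|_{\mathbf{M}}$ for all $s$; its arity is the least possible length of $\overline{x}$. *)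

(* Defs.v *)
From HB Require Import structures.
From mathcomp Require Import all_boot all_order finmap.
From mathcomp Require Import boolp classical_sets functions cardinality.

Set Implicit Arguments.
Unset Strict Implicit.
Unset Printing Implicit Defensive.

Import Order.Theory.
Local Open Scope classical_set_scope.
Local Open Scope card_scope.

(** * First-order logic *)

Record language := Language {
  fun_symb : countType;
  fun_arity : fun_symb -> nat;
  rel_symb : countType;
  rel_arity : rel_symb -> nat
}.

(* [term L V] and [formula L V] are the terms and formulas whose free variables
   are elements of the type [V]; the quantifier binds the [None] of [option V].
   Since relabelling free variables cannot capture, the same types serve for
   - sentences:                       [formula L void];
   - formulas phi(x_0, .., x_{n-1}):  [formula L 'I_n];
   - sentences with parameters in M:  [formula L M];
   - formulas phi(x) in one variable
     with parameters in M:            [formula L (option M)].                *)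
Inductive term (L : language) (V : Type) : Type :=
| Var of V
| App (f : fun_symb L) of ('I_(fun_arity f) -> term L V).

Inductive formula (L : language) (V : Type) : Type :=
| Eq of term L V & term L V
| Rel (r : rel_symb L) of ('I_(rel_arity r) -> term L V)
| Not of formula L V
| And of formula L V & formula L V
| Ex of formula L (option V).

Arguments Var {L V}.
Arguments Ex {L V}.
Arguments Not {L V}.
Arguments And {L V}.

Fixpoint term_map (L : language) (V W : Type) (g : V -> W) (t : term L V) :
    term L W :=
  match t with
  | Var v => Var (g v)
  | App f ts => App (fun i => term_map g (ts i))
  end.

Fixpoint formula_map (L : language) (V W : Type) (g : V -> W)
    (phi : formula L V) : formula L W :=
  match phi with
  | Eq t u => Eq (term_map g t) (term_map g u)
  | Rel r ts => Rel (fun i => term_map g (ts i))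
  | Not psi => Not (formula_map g psi)
  | And psi chi => And (formula_map g psi) (formula_map g chi)
  | Ex psi => Ex (formula_map (omap g) psi)
  end.

(* [phi(a)], for [phi(x)] with parameters in [V] and [a : V]. *)
Definition inst (L : language) (V : Type) (phi : formula L (option V)) (a : V) :
    formula L V :=
  formula_map (oapp id a) phi.

Definition Top (L : language) (V : Type) : formula L V :=
  Ex (Eq (Var None) (Var None)).

Definition unbind0 (n : nat) (V : Type) (v : 'I_n.+1 + V) : option ('I_n + V) :=
  match v with
  | inl i => omap inl (unlift ord0 i)
  | inr w => Some (inr w)
  end.

Definition unbind_nil (V : Type) (v : 'I_0 + V) : V :=
  match v with
  | inl i => False_rect V (notF (ltn_ord i))
  | inr w => w
  end.

(* [exists x_0 .. x_{n-1}, phi], where [inl i : 'I_n + V] is [x_i]. *)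
Fixpoint Exs (L : language) (n : nat) (V : Type) :
    formula L ('I_n + V) -> formula L V :=
  match n with
  | 0 => formula_map (@unbind_nil V)
  | m.+1 => fun phi => Exs (Ex (formula_map (@unbind0 m V) phi))
  end.

(** * Ordinary structures *)

Record structure (L : language) := Structure {
  carrier :> Type;
  carrier_inhabited : inhabited carrier;
  interp_fun : forall f : fun_symb L, ('I_(fun_arity f) -> carrier) -> carrier;
  interp_rel : forall r : rel_symb L, ('I_(rel_arity r) -> carrier) -> Prop
}.

Fixpoint eval (L : language) (S : structure L) (V : Type) (e : V -> S)
    (t : term L V) : S :=
  match t with
  | Var v => e v
  | App f ts => interp_fun (fun i => eval e (ts i))
  end.

Fixpoint sat (L : language) (S : structure L) (V : Type) (e : V -> S)
    (phi : formula L V) : Prop :=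
  match phi with
  | Eq t u => eval e t = eval e u
  | Rel r ts => interp_rel (fun i => eval e (ts i))
  | Not psi => ~ sat e psi
  | And psi chi => sat e psi /\ sat e chi
  | Ex psi => exists a : S, sat (oapp e a) psi
  end.

Lemma eval_map (L : language) (S : structure L) (V W : Type) (g : V -> W)
    (e : W -> S) (t : term L V) : eval e (term_map g t) = eval (e \o g) t.
Proof.
by elim: t => //= f ts IH; congr interp_fun; apply: funext => i.
Qed.

Lemma sat_map (L : language) (S : structure L) (V W : Type) (g : V -> W)
    (e : W -> S) (phi : formula L V) :
  sat e (formula_map g phi) = sat (e \o g) phi.
Proof.
elim: phi W g e => {V} [V t u|V r ts|V phi IH|V phi IH psi IH'|V phi IH] W g e /=.
- by rewrite !eval_map.
- by congr interp_rel; apply: funext => i; rewrite eval_map.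
- by rewrite IH.
- by rewrite IH IH'.
- apply: eq_exists => a; rewrite IH; congr sat.
  by apply: funext => -[v|].
Qed.

Lemma term_map_comp (L : language) (V W X : Type) (g : V -> W) (h : W -> X)
    (t : term L V) : term_map h (term_map g t) = term_map (h \o g) t.
Proof. by elim: t => //= f ts IH; congr App; apply: funext => i. Qed.

Lemma formula_map_comp (L : language) (V W X : Type) (g : V -> W) (h : W -> X)
    (phi : formula L V) :
  formula_map h (formula_map g phi) = formula_map (h \o g) phi.
Proof.
elim: phi W X g h => {V} [V t u|V r ts|V phi IH|V phi IH psi IH'|V phi IH]
  W X g h /=.
- by rewrite !term_map_comp.
- by congr Rel; apply: funext => i; rewrite term_map_comp.
- by rewrite IH.
- by rewrite IH IH'.
- by rewrite IH; congr (Ex (formula_map _ _)); apply: funext => -[].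
Qed.

Lemma term_map_id (L : language) (V : Type) (t : term L V) : term_map id t = t.
Proof. by elim: t => //= f ts IH; congr App; apply: funext => i. Qed.

Lemma formula_map_id (L : language) (V : Type) (phi : formula L V) :
  formula_map id phi = phi.
Proof.
elim: phi => {V} [V t u|V r ts|V phi IH|V phi IH psi IH'|V phi IH] /=.
- by rewrite !term_map_id.
- by congr Rel; apply: funext => i; rewrite term_map_id.
- by rewrite IH.
- by rewrite IH IH'.
- congr Ex; rewrite -[RHS]IH; congr (formula_map _ _).
  by apply: funext => -[].
Qed.

Lemma sat_inst (L : language) (S : structure L) (V : Type) (e : V -> S)
    (phi : formula L (option V)) (a : V) :
  sat e (inst phi a) = sat (oapp e (e a)) phi.
Proof. by rewrite sat_map; congr sat; apply: funext => -[v|]. Qed.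

Lemma sat_bigAnd (L : language) (S : structure L) (V : Type) (e : V -> S)
    (I : eqType) (s : seq I) (phi : I -> formula L V) :
  sat e (\big[And/Top L V]_(i <- s) phi i) <->
  forall i, i \in s -> sat e (phi i).
Proof.
elim: s => [|i s IH].
  rewrite big_nil; split=> // _.
  by have [a] := carrier_inhabited S; exists a.
rewrite big_cons /= IH; split=> [[hi hs] j|h].
  by rewrite inE => /predU1P[->|/hs].
by split=> [|j js]; apply: h; rewrite inE ?eqxx ?js ?orbT.
Qed.

Lemma sat_Exs (L : language) (S : structure L) (n : nat) (V : Type)
    (e : V -> S) (phi : formula L ('I_n + V)) :
  sat e (Exs phi) <->
  exists b : 'I_n -> S,
    sat (fun v => match v with inl i => b i | inr w => e w end) phi.
Proof.
elim: n phi => [|n IH] phi /=.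
  have e0 (b : 'I_0 -> S) :
      (fun v => match v with inl i => b i | inr w => e w end) =
      e \o @unbind_nil V.
    by apply: funext => -[i|w] //; case: (notF (ltn_ord i)).
  rewrite sat_map; split=> [h|[b]]; last by rewrite e0.
  by exists (fun i : 'I_0 => False_rect S (notF (ltn_ord i))); rewrite e0.
rewrite IH /=; split=> [[b [a]]|[b h]].
  rewrite sat_map => h; exists (fun i => oapp b a (unlift ord0 i)).
  move: h; set e1 := _ \o _; set e2 := fun v => _.
  suff -> : e1 = e2 by [].
  by apply: funext => -[i|w] //; rewrite /e1 /e2 /=; case: unlift.
exists (fun i => b (lift ord0 i)), (b ord0); rewrite sat_map.
move: h; set e1 := fun v => _; set e2 := _ \o _.
suff -> : e2 = e1 by [].
apply: funext => -[i|w] //; rewrite /e1 /e2 /=.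
by case: unliftP => [j ->|->].
Qed.

Definition valid (L : language) (V : Type) (phi : formula L V) : Prop :=
  forall (S : structure L) (e : V -> S), sat e phi.

Definition theory (L : language) := set (formula L void).

Definition models (L : language) (S : structure L) (T : theory L) : Prop :=
  forall phi, T phi -> sat (of_void S) phi.

Definition entails (L : language) (T : theory L) (phi : formula L void) : Prop :=
  forall S : structure L, models S T -> sat (of_void S) phi.

Definition complete_theory (L : language) (T : theory L) : Prop :=
  (exists S : structure L, models S T) /\
  (forall phi, entails T phi \/ entails T (Not phi)).

(* [S] is kappa^+-saturated, kappa being the cardinal of [K]. *)
Definition saturated (K : Type) (L : language) (S : structure L) : Prop :=
  forall A : set S, A #<= [set: K] ->
  forall p : set (formula L (option A)),
    (forall q : set (formula L (option A)), finite_set q -> q `<=` p ->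
       exists b : S, forall phi, q phi -> sat (oapp val b) phi) ->
    exists b : S, forall phi, p phi -> sat (oapp val b) phi.

(** * Boolean algebras *)

Section BooleanValued.
Variables (d : Order.disp_t) (B : ctbDistrLatticeType d).

Definition complete_algebra : Prop := forall X : set B, supremums X !=set0.

Record ultrafilter (U : set B) : Prop := Ultrafilter {
  ultrafilter_top : U \top%O;
  ultrafilter_bot : ~ U \bot%O;
  ultrafilter_meet : forall x y, U x -> U y -> U (x `&` y)%O;
  ultrafilter_up : forall x y, (x <= y)%O -> U x -> U y;
  ultrafilter_compl : forall x, U x \/ U (~` x)%O
}.

(** * Full Boolean-valued structures *)

Record full_bstruct (L : language) := FullBStruct {
  bcarrier :> Type;
  value : formula L bcarrier -> B;
  value_valid : forall phi, valid phi -> value phi = \top%O;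
  value_not : forall phi, value (Not phi) = (~` value phi)%O;
  value_and : forall phi psi, value (And phi psi) = (value phi `&` value psi)%O;
  value_ex : forall phi,
    supremums (range (fun a => value (inst phi a))) (value (Ex phi));
  value_eq_lt1 : forall a b : bcarrier,
    a <> b -> (value (Eq (Var a) (Var b)) < \top)%O;
  value_full : forall phi, exists a, value (Ex phi) = value (inst phi a)
}.

Definition bmodels (L : language) (M : full_bstruct L) (T : theory L) : Prop :=
  forall phi, T phi -> value (formula_map (of_void M) phi) = \top%O.

Definition elementary (L : language) (M N : full_bstruct L) (f : M -> N) : Prop :=
  forall phi : formula L M, value (formula_map f phi) = value phi.

(* The elementary inclusion of M0 in N0 is rendered by an elementary map [i];
   such maps are injective by [value_eq_lt1]. *)
Definition bsaturated (K : Type) (L : language) (T : theory L)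
    (M : full_bstruct L) : Prop :=
  bmodels M T /\
  forall (M0 N0 : full_bstruct L) (i : M0 -> N0),
    elementary i -> bmodels N0 T -> [set: N0] #<= [set: K] ->
    forall f : M0 -> M, elementary f ->
    exists g : N0 -> M, elementary g /\ forall a, g (i a) = f a.

(* [S], together with the surjection [pi], is the specialization M/U; this
   determines [S] up to isomorphism, and [specialization_exists] below shows
   that it exists. *)
Definition specialization (L : language) (U : set B) (M : full_bstruct L)
    (S : structure L) (pi : M -> S) : Prop :=
  (forall s : S, exists a : M, pi a = s) /\
  (forall phi : formula L M, U (value phi) <-> sat pi phi).

(* [U] kappa^+-saturates [T], kappa being the cardinal of [K]. *)
Definition saturates (K : Type) (L : language) (U : set B) (T : theory L) : Prop :=
  forall M : full_bstruct L, bsaturated K T M ->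
  forall (S : structure L) (pi : M -> S),
    specialization U pi -> saturated K S.

(** * Distributions *)

Section Distributions.
Variable K : choiceType.
Local Open Scope fset_scope.

Record distribution (A : {fset K} -> B) : Prop := Distribution {
  distribution_neq0 : forall s, A s <> \bot%O;
  distribution_fset0 : A fset0 = \top%O;
  distribution_decr : forall s t : {fset K}, s `<=` t -> (A t <= A s)%O
}.

Definition dist_in (U : set B) (A : {fset K} -> B) : Prop := forall s, U (A s).

Definition multiplicative (A : {fset K} -> B) : Prop :=
  forall s : {fset K}, A s = (\meet_(i <- s) A [fset i])%O.

Definition refines (A' A : {fset K} -> B) : Prop := forall s, (A' s <= A s)%O.

(* The formula phi_i(x, y_i) has its own type ['I_(m i)] of variables y_i, so
   that disjointness from x and from the other y_j is built in. *)
Definition los_map_of_length (L : language) (T : theory L)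
    (A : {fset K} -> B) (n : nat) : Prop :=
  distribution A /\
  exists (m : K -> nat) (phi : forall i, formula L ('I_n + 'I_(m i)))
         (M : full_bstruct L) (a : forall i, 'I_(m i) -> M),
    bmodels M T /\
    forall s : {fset K},
      A s = value (Exs (\big[And/Top L ('I_n + M)]_(i <- s)
              formula_map (fun v => match v with
                                    | inl x => inl x
                                    | inr y => inr (a i y)
                                    end) (phi i))).

Definition los_map (L : language) (T : theory L) (A : {fset K} -> B) : Prop :=
  exists n, los_map_of_length T A n.

Definition los_arity (L : language) (T : theory L) (A : {fset K} -> B)
    (n : nat) : Prop :=
  los_map_of_length T A n /\ forall k, los_map_of_length T A k -> n <= k.

Definition has_mult_refinement (U : set B) (A : {fset K} -> B) : Prop :=
  exists A' : {fset K} -> B,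
    [/\ distribution A', dist_in U A', multiplicative A' & refines A' A].

End Distributions.
End BooleanValued.

(** * Existence of specializations *)

Section SpecializationExists.
Variables (d : Order.disp_t) (B : ctbDistrLatticeType d) (L : language).
Variables (U : set B) (M : full_bstruct B L).
Hypothesis hU : ultrafilter U.

Local Notation holds phi := (U (value phi)) (only parsing).

Lemma holds_not (phi : formula L M) : holds (Not phi) <-> ~ holds phi.
Proof.
rewrite value_not; split=> [hn h|h]; last first.
  by have [|//] := ultrafilter_compl hU (value phi).
by apply: (ultrafilter_bot hU); rewrite -(meetxC (value phi));
   apply: ultrafilter_meet.
Qed.

Lemma holds_and (phi psi : formula L M) :
  holds (And phi psi) <-> holds phi /\ holds psi.
Proof.
rewrite value_and; split=> [h|[]]; last exact: ultrafilter_meet.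
by split; apply: (ultrafilter_up hU _ h); rewrite ?leIl ?leIr.
Qed.

Lemma holds_ex (phi : formula L (option M)) :
  holds (Ex phi) <-> exists a, holds (inst phi a).
Proof.
split=> [|[a h]]; first by have [a ->] := value_full phi; exists a.
apply: (ultrafilter_up hU _ h).
by have [ub _] := value_ex phi; apply: ub; exists a.
Qed.

Lemma holds_valid (phi : formula L M) : valid phi -> holds phi.
Proof. by move=> /value_valid ->; exact: ultrafilter_top. Qed.

Lemma holds_bigAnd n (phi : 'I_n -> formula L M) :
  (forall i, holds (phi i)) -> holds (\big[And/Top L M]_(i <- enum 'I_n) phi i).
Proof.
move=> h; elim: (enum _) => [|i s IH]; rewrite ?big_nil ?big_cons.
  by apply: holds_valid => S e; have [a] := carrier_inhabited S; exists a.
by apply/holds_and.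
Qed.

Lemma holds_imp (phi psi : formula L M) :
  (forall (S : structure L) (e : M -> S), sat e phi -> sat e psi) ->
  holds phi -> holds psi.
Proof.
move=> h hphi; apply: contrapT => /holds_not hn.
have /holds_not[] : holds (Not (And phi (Not psi))).
  by apply: holds_valid => S e /= [/h].
exact/holds_and.
Qed.

Definition ueq (a b : M) := holds (Eq (Var a) (Var b)).

Definition spec_carrier := {c : set M | exists a, c = ueq a}.

Definition spec_class (a : M) : spec_carrier :=
  exist _ (ueq a) (ex_intro _ a erefl).

Definition spec_repr (c : spec_carrier) : M := sval (cid (svalP c)).

Lemma spec_reprK c : spec_class (spec_repr c) = c.
Proof.
by case: c => c hc; apply: eq_exist; rewrite /spec_repr; case: cid => a /= ->.
Qed.

Lemma ueqP a b : spec_class a = spec_class b <-> ueq a b.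
Proof.
split=> [[ab]|ab].
  have : ueq b b by apply: holds_valid.
  by rewrite -ab.
apply: eq_exist; apply/predeqP => c; split.
  move=> ac; have /holds_and := conj ab ac.
  by apply: holds_imp => S e /= [-> ->].
move=> bc; have /holds_and := conj ab bc.
by apply: holds_imp => S e /= [-> ->].
Qed.

Lemma spec_inhabited : inhabited spec_carrier.
Proof.
have [a _] := value_full (Top L (option M)).
by constructor; exact: spec_class a.
Qed.

Lemma term_value (t : term L M) :
  exists a : M, holds (Eq t (Var a)).
Proof.
have /holds_ex[a ha] :
    holds (Ex (Eq (term_map some t) (Var None)) : formula L M).
  apply: holds_valid => S e; exists (eval e t).
  by rewrite /= eval_map; congr eval.
exists a; apply: holds_imp ha => S e; rewrite sat_inst /= eval_map.
by move=> <-; congr eval.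
Qed.

Definition spec_fun (f : fun_symb L) (c : 'I_(fun_arity f) -> spec_carrier) :=
  spec_class (sval (cid (term_value (App (fun i => Var (spec_repr (c i))))))).

Definition spec_rel (r : rel_symb L) (c : 'I_(rel_arity r) -> spec_carrier) :=
  holds (Rel (fun i => Var (spec_repr (c i)))).

Definition spec : structure L := Structure spec_inhabited spec_fun spec_rel.

Lemma holds_eval (t : term L M) :
  holds (Eq t (Var (spec_repr (@eval L spec M spec_class t)))).
Proof.
elim: t => [a|f ts IH] /=.
  by apply/ueqP; rewrite spec_reprK.
rewrite /spec_fun; set t := (X in term_value X).
set a := sval (cid (term_value t)).
have hb : holds (Eq t (Var (spec_repr (spec_class a)))).
  have /ueqP ha : spec_class a = spec_class (spec_repr (spec_class a)).
    by rewrite spec_reprK.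
  have /holds_and := conj (svalP (cid (term_value t))) ha.
  by apply: holds_imp => S e /= [-> ->].
have /holds_and := conj (holds_bigAnd IH) hb.
apply: holds_imp => S e /= [/sat_bigAnd h <-].
congr interp_fun; apply: funext => i.
by have := h i (mem_enum _ _).
Qed.

Lemma spec_sat (phi : formula L M) :
  holds phi <-> @sat L spec M spec_class phi.
Proof.
suff H V (psi : formula L V) (e : V -> M) :
    holds (formula_map e psi) <-> @sat L spec V (spec_class \o e) psi.
  by have := H _ phi id; rewrite formula_map_id.
elim: psi e => {V} [V t u|V r ts|V psi IH|V psi IH chi IH'|V psi IH] e /=.
- rewrite -!(@eval_map L spec).
  have ht := holds_eval (term_map e t); have hu := holds_eval (term_map e u).
  set a := eval _ _ in ht *; set b := eval _ _ in hu *.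
  have -> : a = b <-> ueq (spec_repr a) (spec_repr b).
    by rewrite -ueqP !spec_reprK.
  split=> h; have /holds_and/(conj h)/holds_and := conj ht hu.
    by apply: holds_imp => S e' /= [-> [-> ->]].
  by apply: holds_imp => S e' /= [-> [-> ->]].
- have := holds_bigAnd (fun i => holds_eval (term_map e (ts i))).
  under [X in spec_rel X]funext do rewrite -(@eval_map L spec).
  rewrite /spec_rel => h1; split=> h2; have /holds_and := conj h1 h2;
    apply: holds_imp => S e' /= [/sat_bigAnd h3]; congr interp_rel;
    apply: funext => i; by have := h3 i (mem_enum _ _).
- by rewrite holds_not IH.
- by rewrite holds_and IH IH'.
- rewrite holds_ex; split=> -[a].
    rewrite /inst formula_map_comp IH => h; exists (spec_class a).
    move: h; set e1 := _ \o _; set e2 := oapp _ _.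
    by suff -> : e1 = e2 by []; apply: funext => -[].
  move=> h; exists (spec_repr a); rewrite /inst formula_map_comp IH.
  move: h; set e1 := oapp _ _; set e2 := _ \o _.
  suff -> : e2 = e1 by [].
  by apply: funext => -[v|] //; exact: spec_reprK.
Qed.

End SpecializationExists.

Lemma specialization_exists (d : Order.disp_t) (B : ctbDistrLatticeType d)
    (L : language) (U : set B) (M : full_bstruct B L) :
  ultrafilter U ->
  exists (S : structure L) (pi : M -> S), specialization U pi.
Proof.
move=> hU; exists (spec M hU), (@spec_class _ _ _ U M).
split=> [c|phi]; last exact: spec_sat.
by exists (spec_repr c); exact: spec_reprK.
Qed.

(* Main.v *)
Require Import Defs.
From HB Require Import structures.
From mathcomp Require Import all_boot all_order finmap.
From mathcomp Require Import boolp classical_sets functions cardinality.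

(* If M is saturated and M/U realizes the type of a Los map A at the class of a
   tuple b, then the values of phi_i(b, a_i) lie in U, and their finite meets
   form a multiplicative refinement of A. Conversely, let A' be a multiplicative
   refinement in U of the Los map of a 1-type over parameters lifted to a
   saturated M. The constraints "the value of phi_i(x, a_i) is at least A'({i})"
   are consistent with the elementary diagram of a small elementary substructure
   of M, hence are satisfied in a small full extension of it; by saturation some
   b in M satisfies them, and the class of b realizes the type in M/U.
   A Los map of length 0 is already multiplicative, so arity 1 suffices.

   Values in B are handled through B-valued theories, that is, homomorphisms
   from formulas modulo validity to B. Completeness of B gives a compactness
   theorem for them, hence amalgamation. A saturated full extension is obtained
   by Zorn's lemma on theories over sets of constants taken from one inductive
   type, in which every small amalgamation problem has its own fresh names. *)

Set Implicit Arguments.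
Unset Strict Implicit.
Unset Printing Implicit Defensive.

Import Order.Theory.
Local Open Scope classical_set_scope.

(** * Embeddings into an infinite type *)

Definition embeds (X Y : Type) : Prop := exists f : X -> Y, injective f.

Lemma embeds_trans X Y Z : embeds X Y -> embeds Y Z -> embeds X Z.
Proof. by move=> [f hf] [g hg]; exists (g \o f); exact: inj_comp. Qed.

Lemma embeds_set (X Y : Type) (A : set X) :
  card_le A [set: Y] <-> embeds A Y.
Proof.
split=> [/card_leP[f]|[f hf]].
  exists (fun x => val (f x)) => x y /val_inj h.
  by apply: (inj (f := f)); rewrite ?inE.
apply/card_leP; have mT y : y \in [set: Y] by rewrite inE.
have fF : set_fun [set: A] [set: [set: Y]] (fun x => exist _ (f x) (mT (f x))).
  by [].
have fI : set_inj [set: A] (fun x => exist (fun y => y \in [set: Y]) (f x) (mT (f x))).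
  by move=> x y _ _ [/hf].
by apply/injfunPex; exists (fun x => exist _ (f x) (mT (f x))).
Qed.

Lemma embeds_setT (X Y : Type) : card_le [set: X] [set: Y] <-> embeds X Y.
Proof.
rewrite embeds_set; split=> [[f hf]|[f hf]].
  exists (fun x => f (exist _ x (in_setT x))) => x y /hf.
  by move=> /(congr1 val).
by exists (f \o val) => x y /hf /val_inj.
Qed.

Lemma embeds_range (X Y Z : Type) (e : X -> Y) :
  embeds X Z -> embeds (range e) Z.
Proof.
move=> [f hf].
have h (y : range e) : exists x, e x = val y.
  by case: y => y /=; rewrite inE => -[x _ <-]; exists x.
exists (fun y => f (sval (cid (h y)))) => y z /hf yz; apply: val_inj.
by rewrite -(svalP (cid (h y))) -(svalP (cid (h z))) yz.
Qed.

(** Turns a nonempty small type into an image of [K], so that whatever it indexes can be reindexed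
    by [K] itself; points of [Y] off the image of [f] go to [x0]. *)
Lemma embeds_retraction (X Y : Type) :
  embeds X Y -> X -> exists (q : Y -> X) (s : X -> Y), cancel s q.
Proof.
move=> [f hf] x0.
exists (fun y => if pselect (exists x, f x = y) is left h then sval (cid h) else x0), f.
move=> x; case: pselect => [h|[]]; last by exists x.
exact/hf/(svalP (cid h)).
Qed.

(* Zorn's lemma on graphs of partial injections. *)
Lemma embeds_total (X Y : Type) : embeds X Y \/ embeds Y X.
Proof.
pose P (G : set (X * Y)) := forall p q, G p -> G q -> p.1 = q.1 <-> p.2 = q.2.
have [F FP Ft|G [PG mG]] := @Zorn_bigcup (X * Y)%type P.
  move=> p q [G FG Gp] [H FH Hq]; have [GH|HG] := Ft _ _ FG FH.
    by apply: (FP H) => //; exact: GH.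
  by apply: (FP G) => //; exact: HG.
have [hX|/existsNP[x hx]] := pselect (forall x, exists y, G (x, y)).
  left; exists (fun x => sval (cid (hX x))) => x x'.
  by have /= := PG _ _ (svalP (cid (hX x))) (svalP (cid (hX x'))) => ->.
have [hY|/existsNP[y hy]] := pselect (forall y, exists x, G (x, y)).
  right; exists (fun y => sval (cid (hY y))) => y y'.
  by have /= := PG _ _ (svalP (cid (hY y))) (svalP (cid (hY y'))) => <-.
exfalso; apply: (mG (G `|` [set (x, y)])).
  rewrite properEneq; split; last exact: subsetUl.
  apply/eqP => e; apply: hx; exists y; rewrite e; by right.
move=> [a b] [a' b'] [h|[-> ->]] [h'|[-> ->]] //=; first exact: (PG _ _ h h').
- by split=> e; subst; [case: hx; exists b|case: hy; exists a].
- by split=> e; subst; [case: hx; exists b'|case: hy; exists a'].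
Qed.

(** * Hessenberg's theorem on squares of infinite types *)

Section Hessenberg.
Variable K : Type.
Hypothesis hK : embeds nat K.

(* Zorn's lemma on injections [X * X * nat -> X] with [X] a subset of [K]; the
   factor [nat] provides the finitely many tags needed to extend such an
   injection to the union of [X] with a disjoint copy of itself. *)
Let state := (set K * (K -> K -> nat -> K))%type.

Let good (s : state) :=
  (forall x y n, s.1 x -> s.1 y -> s.1 (s.2 x y n)) /\
  (forall x y n x' y' n', s.1 x -> s.1 y -> s.1 x' -> s.1 y' ->
    s.2 x y n = s.2 x' y' n' -> [/\ x = x', y = y' & n = n']).

Let ext (s t : state) :=
  s.1 `<=` t.1 /\ forall x y n, s.1 x -> s.1 y -> s.2 x y n = t.2 x y n.

Let ext_trans s t u : ext s t -> ext t u -> ext s u.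
Proof.
move=> [st est] [tu etu]; split; first exact: subset_trans tu.
by move=> x y n sx sy; rewrite est // etu //; exact: st.
Qed.

(** Starting point for Zorn's lemma: on the countable set [range c], triples of natural numbers are
    coded by one natural number. *)
Let good0 : exists s, good s /\ s.1 !=set0.
Proof.
have [c hc] := hK.
pose d x : nat := if pselect (exists n, c n = x) is left h then sval (cid h) else 0.
have cK n : d (c n) = n.
  by rewrite /d; case: pselect => [h|[]]; [exact/hc/(svalP (cid h))|exists n].
exists (range c, fun x y (n : nat) => c (choice.pickle ((d x, d y, n) : nat * nat * nat))); split; last by exists (c 0), 0.
split=> /= [x y n _ _|_ _ n _ _ n' [x _ <-] [y _ <-] [x' _ <-] [y' _ <-]].
  by exists (choice.pickle ((d x, d y, n) : nat * nat * nat)).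
rewrite !cK => /hc /(pcan_inj choice.pickleK) [].
by move=> -> -> ->.
Qed.

Let maximal_state : exists s, [/\ good s, s.1 !=set0 &
  forall t, good t -> ext s t -> t.1 `<=` s.1].
Proof.
pose T := {s : state | good s /\ s.1 !=set0}.
pose R (s t : T) := `[< ext (sval s) (sval t) >].
have [s0 hs0] := good0.
have [] := @ZL_preorder T (exist _ s0 hs0) R.
- by move=> t; apply/asboolP; split.
- by move=> r s t /asboolP rs /asboolP st; apply/asboolP; exact: ext_trans st.
- move=> A Atot; have [[a Aa]|A0] := pselect (A !=set0); last first.
    by exists (exist _ s0 hs0) => s As; case: A0; exists s.
  have two s t : A s -> A t -> exists u, [/\ A u, ext (sval s) (sval u) & ext (sval t) (sval u)].
    move=> As At; have [/asboolP h|/asboolP h] := Atot _ _ As At.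
      by exists t; split=> //; split.
    by exists s; split=> //; split.
  pose f x y n := if pselect (exists s : T, [/\ A s, (sval s).1 x & (sval s).1 y])
    is left h then (sval (sval (cid h))).2 x y n else x.
  have fE s x y n : A s -> (sval s).1 x -> (sval s).1 y -> f x y n = (sval s).2 x y n.
    move=> As sx sy; rewrite /f; case: pselect => [h|[]]; last by exists s.
    case: (svalP (cid h)); set t := sval (cid h) => At tx ty.
    have [u [_ [_ ->] // [_ ->]]] := two _ _ At As; by [].
  pose X := \bigcup_(s in A) (sval s).1.
  have up x y : X x -> X y -> exists s, [/\ A s, (sval s).1 x & (sval s).1 y].
    move=> [s As sx] [t At ty]; have [u [Au [su _] [tu _]]] := two _ _ As At.
    by exists u; split; [|exact: su|exact: tu].
  have gX : good (X, f) /\ X !=set0.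
    split; last first.
      by case: (svalP a) => _ [x ax]; exists x, a.
    split=> /= [x y n /up h /h[s [As sx sy]]|x y n x' y' n' /up h /h{h}[s [As sx sy]]].
      by rewrite (fE s) //; exists s => //; case: (svalP s) => -[+ _] _; apply.
    move=> /up h /h{h}[s' [As' sx' sy']].
    have [u [Au [su _] [su' _]]] := two _ _ As As'.
    rewrite !(fE u) //; try solve [exact: su|exact: su'].
    by case: (svalP u) => -[_ +] _; apply; try solve [exact: su|exact: su'].
  exists (exist _ (X, f) gX) => s As; apply/asboolP; split=> /= [x sx|x y n sx sy].
    by exists s.
  by rewrite (fE s).
move=> [s [gs s0' ]] ms; exists s; split=> // t gt st.
have t0 : t.1 !=set0 by have [x sx] := s0'; exists x; exact: st.1.
by have /asboolP[] := ms (exist _ t (conj gt t0)) (asboolT st).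
Qed.

(** For [X] maximal, compare [X] with its complement. If [X] embeds in the complement, adjoining the
    disjoint copy of [X] under [g] contradicts maximality. Otherwise the complement embeds in [X],
    every point of [K] becomes a tagged point of [X], and [f] codes pairs of these. *)
Lemma embeds_square : embeds (K * K) K.
Proof.
have [[X f] [[/= fX fI] [x0 /= Xx0] mX]] := maximal_state.
pose code (a b : bool) (n : nat) : nat := choice.pickle (a, b, n).
have codeI a b n a' b' n' : code a b n = code a' b' n' -> (a, b, n) = (a', b', n').
  exact: (pcan_inj choice.pickleK).
have pairI (p q : bool * K) : p.2 = q.2 -> p.1 = q.1 -> p = q.
  by case: p q => [? ?] [? ?] /= -> ->.
have [[h hh]|[h hh]] := embeds_total X (~` X).
  exfalso.
  pose g x := if pselect (x \in X) is left p then val (h (exist _ x p)) else x.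
  have gE x : X x -> ~ X (g x).
    move=> Xx; rewrite /g; case: pselect => [p|[]]; last by rewrite inE.
    by have := valP (h (exist _ x p)); rewrite inE.
  have gI x y : X x -> X y -> g x = g y -> x = y.
    move=> Xx Xy; rewrite /g; case: pselect => [p|[]]; last by rewrite inE.
    case: pselect => [q|[]]; last by rewrite inE.
    by move=> /val_inj /hh [].
  pose X' := X `|` [set y | exists2 x, X x & g x = y].
  have /choice[k kP] y : exists c : bool * K, X' y ->
      X c.2 /\ y = (if c.1 then c.2 else g c.2).
    have [Xy|nXy] := pselect (X y); first by exists (true, y).
    have [[x Xx gx]|nY] := pselect (exists2 x, X x & g x = y).
      by exists (false, x).
    by exists (true, y) => -[].
  have kX y : X' y -> X (k y).2 by move=> /kP[].
  have kI y y' : X' y -> X' y' -> k y = k y' -> y = y'.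
    by move=> /kP[_ {2}->] /kP[_ {2}->] ->.
  pose v x y n := f (k x).2 (k y).2 (code (k x).1 (k y).1 n).
  have Xv x y n : X' x -> X' y -> X (v x y n) by move=> hx hy; apply: fX; exact: kX.
  (* Pairs inside [X] keep their code, while pairs meeting the copy are coded inside the copy, so
     the two kinds never collide. The booleans in [code] tell originals from copies. *)
  pose F x y n := if pselect (X x /\ X y) then f x y n else g (v x y n).
  suff : X' `<=` X.
    by move=> /(_ (g x0)) h'; apply: (gE x0) => //; apply: h'; right; exists x0.
  apply: (mX (X', F)); last first.
    split=> [x Xx|x y n Xx Xy]; first by left.
    by rewrite /= /F; case: pselect => // -[].
  split=> [x y n hx hy|x y n x' y' n' hx hy hx' hy']; rewrite /= /F.
    case: pselect => [[Xx Xy]|nX]; first by left; exact: fX.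
    by right; exists (v x y n) => //; exact: Xv.
  case: pselect => [[Xx Xy]|nX]; case: pselect => [[Xx' Xy']|nX'].
  - exact: fI.
  - by move=> /= e; case: (gE (v x' y' n')); [exact: Xv|rewrite -e; exact: fX].
  - by move=> /= e; case: (gE (v x y n)); [exact: Xv|rewrite e; exact: fX].
  - move=> /= /(gI _ _ (Xv _ _ _ hx hy) (Xv _ _ _ hx' hy')) /fI [].
    + exact: kX.
    + exact: kX.
    + exact: kX.
    + exact: kX.
    + by move=> e e' /codeI [ea eb ->]; split=> //; apply: kI => //; exact: pairI.
pose k x : bool * K := if pselect (x \in ~` X) is left p then (false, val (h (exist _ x p)))
  else (true, x).
have kX x : X (k x).2.
  rewrite /k; case: pselect => [p|]; first by have := valP (h (exist _ x p)); rewrite inE.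
  by move=> hx; apply: contrapT => hX; case: hx; rewrite inE.
have kI : injective k.
  move=> x y; rewrite /k; case: pselect => p; case: pselect => q //= [] //.
  by move=> /val_inj /hh [].
exists (fun z => f (k z.1).2 (k z.2).2 (code (k z.1).1 (k z.2).1 0)).
move=> [x y] [x' y'] /fI [] //= ex ey /codeI [ex' ey'].
by congr pair; apply: kI; exact: pairI.
Qed.
End Hessenberg.

(** * Constructions that do not exceed an infinite cardinal *)

Section InfiniteEmbeddings.
Variable K : Type.
Hypothesis hK : embeds nat K.

Lemma embeds_prod (X Y : Type) : embeds X K -> embeds Y K -> embeds (X * Y) K.
Proof.
move=> [f hf] [g hg]; apply: embeds_trans (embeds_square hK).
by exists (fun z => (f z.1, g z.2)) => -[x y] [x' y'] /= [/hf -> /hg ->].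
Qed.

Lemma embeds_sum (X Y : Type) : embeds X K -> embeds Y K -> embeds (X + Y) K.
Proof.
move=> [f hf] [g hg]; have [c hc] := hK.
apply: embeds_trans (embeds_square hK).
exists (fun z => match z with inl x => (c 0, f x) | inr y => (c 1, g y) end).
by move=> [x|y] [x'|y'] [] => [/hf->|/hc|/hc|/hg->].
Qed.

Lemma embeds_option (X : Type) : embeds X K -> embeds (option X) K.
Proof.
move=> hX; have [c _] := hK.
apply: embeds_trans (embeds_sum (X := unit) _ hX); last first.
  by exists (fun=> c 0) => -[] [].
by exists (fun x => if x is Some y then inr y else inl tt) => -[x|] [y|] // [->].
Qed.

Lemma embeds_countable (X : countType) : embeds X K.
Proof.
by apply: embeds_trans hK; exists choice.pickle; exact: (pcan_inj choice.pickleK).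
Qed.

Lemma embeds_seq (X : Type) : embeds X K -> embeds (seq X) K.
Proof.
move=> [f hf]; have [c hc] := hK; have [p hp] := embeds_square hK.
(* The length is stored beside [code], since the end mark [c 0] may itself be a value of [p]. *)
pose code := foldr (fun x k => p (f x, k)) (c 0).
exists (fun s => p (c (size s), code s)) => s t /hp [/hc].
elim: s t => [|x s IH] [|y t] //= [st] /hp [/hf -> e].
by rewrite (IH t).
Qed.

Lemma embeds_tree (X : Type) : embeds X K -> embeds (GenTree.tree X) K.
Proof.
move=> hX; apply: (@embeds_trans _ (seq (nat + X))).
  by exists (@GenTree.encode X); exact: (pcan_inj (GenTree.codeK X)).
exact: embeds_seq (embeds_sum hK hX).
Qed.

(** * Coding terms and formulas by finite trees *)

Section Formulas.
Variable L : language.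

Fixpoint term_tree (V : Type) (e : V -> K) (t : term L V) : GenTree.tree K :=
  match t with
  | Var v => GenTree.Leaf (e v)
  | App f ts => GenTree.Node (choice.pickle f)
      [seq term_tree e (ts i) | i <- enum 'I_(fun_arity f)]
  end.

(* Binders shift the leaves along an injection [s : option K -> K]. *)
Fixpoint formula_tree (s : option K -> K) (V : Type) (e : V -> K)
    (phi : formula L V) : GenTree.tree K :=
  match phi with
  | Eq t u => GenTree.Node 0 [:: term_tree e t; term_tree e u]
  | Rel r ts => GenTree.Node (choice.pickle r).+4
      [seq term_tree e (ts i) | i <- enum 'I_(rel_arity r)]
  | Not psi => GenTree.Node 1 [:: formula_tree s e psi]
  | And psi chi => GenTree.Node 2 [:: formula_tree s e psi; formula_tree s e chi]
  | Ex psi => GenTree.Node 3 [:: formula_tree s (s \o omap e) psi]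
  end.

Lemma eq_map_enum (T : Type) n (f g : 'I_n -> T) :
  [seq f i | i <- enum 'I_n] = [seq g i | i <- enum 'I_n] -> f =1 g.
Proof.
move=> e i; move: (mem_enum 'I_n i); rewrite inE; elim: (enum _) e => //= j s IH.
by move=> [e1 /IH{}IH]; rewrite inE => /predU1P[->|/IH].
Qed.

Lemma term_tree_inj (V : Type) (e : V -> K) :
  injective e -> injective (term_tree e).
Proof.
move=> he; elim=> [v|f ts IH] [w|g us] //=; first by move=> [/he ->].
move=> [/(pcan_inj choice.pickleK) fg]; case: g / fg us => us h.
by congr App; apply: funext => i; apply: IH; exact: (eq_map_enum h).
Qed.

Lemma formula_tree_inj (s : option K -> K) (V : Type) (e : V -> K) :
  injective s -> injective e -> injective (formula_tree s e).
Proof.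
move=> hs he phi; elim: phi e he => {V} [V t u|V r ts|V phi IH|V phi IH chi IH'|V phi IH]
   e he [t' u'|r' ts'|psi|psi psi'|psi] //=.
- by move=> [/(term_tree_inj he) -> /(term_tree_inj he) ->].
- move=> [/(pcan_inj choice.pickleK) rr]; case: r' / rr ts' => ts' h.
  by congr Rel; apply: funext => i; apply: (term_tree_inj he); exact: (eq_map_enum h).
- by move=> [/(IH _ he) ->].
- by move=> [/(IH _ he) -> /(IH' _ he) ->].
- by move=> [/IH -> //]; apply: inj_comp hs _ => -[x|] [y|] //= [/he ->].
Qed.

Lemma embeds_formula (V : Type) : embeds V K -> embeds (formula L V) K.
Proof.
have hKK : embeds K K by exists id.
move=> [e he]; have [s hs] := embeds_option hKK.
by apply: embeds_trans (embeds_tree hKK); exists (formula_tree s e); exact: formula_tree_inj.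
Qed.

End Formulas.
End InfiniteEmbeddings.

(** * Boolean-valued theories *)

Section Syntax.
Variable L : language.

Lemma valid_map (V W : Type) (g : V -> W) (phi : formula L V) :
  valid phi -> valid (formula_map g phi).
Proof. by move=> h S e; rewrite sat_map; exact: h. Qed.

(** An assignment on [V] extends along the injection [g], with an arbitrary value off its range.
    This allows a formula to be moved between different sets of constants. *)
Lemma valid_map_inj (V W : Type) (g : V -> W) (phi : formula L V) :
  injective g -> valid (formula_map g phi) -> valid phi.
Proof.
move=> hg h S e; have [s0] := carrier_inhabited S.
pose e' w := if pselect (exists v, g v = w) is left p then e (sval (cid p)) else s0.
have <- : e' \o g = e; last by rewrite -sat_map; exact: h.
apply: funext => v; rewrite /e' /=; case: pselect => [p|[]]; last by exists v.
by congr e; apply: hg; exact: svalP (cid p).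
Qed.

Definition ent (V : Type) (phi psi : formula L V) : Prop :=
  forall (S : structure L) (e : V -> S), sat e phi -> sat e psi.

Definition unsat (V : Type) (phi : formula L V) : Prop :=
  forall (S : structure L) (e : V -> S), ~ sat e phi.

Lemma valid_Top (V : Type) : valid (Top L V).
Proof. by move=> S e; have [a] := carrier_inhabited S; exists a. Qed.

(** The support is packed into a single sigma type so that [choice] selects it for all arguments of
    a symbol at once. *)
Definition term_support (V : Type) (t : term L V)
    (p : {n & (('I_n -> V) * term L 'I_n)%type}) : Prop :=
  t = term_map (tagged p).1 (tagged p).2.

Lemma term_support_fin (V : Type) (F : finType) (g : F -> V) (t : term L F) :
  exists p, term_support (term_map g t) p.
Proof.
exists (Tagged (fun n => (('I_n -> V) * term L 'I_n)%type)
  (g \o enum_val, term_map enum_rank t)).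
rewrite /term_support /= term_map_comp; congr term_map.
by apply: funext => x; rewrite /= enum_rankK.
Qed.

Lemma term_has_support (V : Type) (t : term L V) : exists p, term_support t p.
Proof.
elim: t => [v|f ts /choice[p hp]].
  exact: (@term_support_fin _ unit (fun=> v) (Var tt)).
pose F := {i : 'I_(fun_arity f) & 'I_(tag (p i))}.
pose g (x : F) := (tagged (p (tag x))).1 (tagged x).
have -> : ts = fun i => term_map g (term_map
    (fun x => Tagged (fun i => 'I_(tag (p i))) x) (tagged (p i)).2).
  by apply: funext => i; rewrite term_map_comp hp.
exact: (@term_support_fin V F g (App (fun i => term_map _ _))).
Qed.

Lemma formula_fin (V : Type) (F : finType) (g : F -> V) (phi : formula L F) :
  exists n (h : 'I_n -> V) (psi : formula L 'I_n),
    formula_map g phi = formula_map h psi.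
Proof.
exists #|F|, (g \o enum_val), (formula_map enum_rank phi).
rewrite formula_map_comp; congr formula_map.
by apply: funext => x; rewrite /= enum_rankK.
Qed.

Lemma formula_has_support (V : Type) (phi : formula L V) :
  exists n (g : 'I_n -> V) (psi : formula L 'I_n), phi = formula_map g psi.
Proof.
elim: phi => {V} [V t u|V r ts|V phi [n [g [psi ->]]]
  |V phi [n [g [psi ->]]] chi [m [h [theta ->]]]|V phi [n [g [psi ->]]]].
- have [[n [g t']] ->] := term_has_support t.
  have [[m [h u']] ->] := term_has_support u => /=.
  have := @formula_fin V ('I_n + 'I_m)%type (fun x => match x with inl i => g i | inr j => h j end)
    (Eq (term_map inl t') (term_map inr u')).
  by rewrite /= !term_map_comp.
- have /choice[p hp] i := term_has_support (ts i).
  pose F := {i : 'I_(rel_arity r) & 'I_(tag (p i))}.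
  pose g (x : F) := (tagged (p (tag x))).1 (tagged x).
  have -> : ts = fun i => term_map g (term_map
      (fun x => Tagged (fun i => 'I_(tag (p i))) x) (tagged (p i)).2).
    by apply: funext => i; rewrite term_map_comp hp.
  exact: (@formula_fin V F g (Rel (fun i => term_map _ _))).
- by exists n, g, (Not psi).
- have := @formula_fin V ('I_n + 'I_m)%type (fun x => match x with inl i => g i | inr j => h j end)
    (And (formula_map inl psi) (formula_map inr theta)).
  by rewrite /= !formula_map_comp.
(* [F] keeps the indices that name free variables; [insub] sends the others, which name the bound
   variable, to [None]. *)
- pose F := {i : 'I_n | isSome (g i)}.
  have /choice[h hh] (x : F) : exists v, g (val x) = Some v.
    by case: x => x /=; case: (g x) => // v _; exists v.
  have -> : formula_map g psi = formula_map (omap h) (formula_map (insub : _ -> option F) psi).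
    rewrite formula_map_comp; congr formula_map; apply: funext => x /=.
    case: insubP => [y _ <-|]; first by rewrite hh.
    by case: (g x).
  exact: (@formula_fin V F h (Ex _)).
Qed.

(* [theta] quantifies out the variables of [phi] that lie outside [E]. *)
Lemma formula_project (V : Type) (E : set V) (phi : formula L V) :
  exists theta : formula L E, forall (S : structure L) (e : E -> S),
    sat e theta <-> exists2 e' : V -> S, (forall x : E, e' (val x) = e x) & sat e' phi.
Proof.
have [n [g [psi ->]]] := formula_has_support phi.
(* [g] need not be injective: [r] picks one index per variable, so that a variable occurring under
   several indices is quantified only once. *)
pose r (i : 'I_n) := odflt i [pick j | `[< g j = g i >]].
have gr i : g (r i) = g i.
  by rewrite /r; case: pickP => [j /asboolP //|/(_ i)]; rewrite asboolT.
have rg i j : g i = g j -> r i = r j.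
  move=> ij; rewrite /r; under eq_pick do rewrite ij.
  by case: pickP => // /(_ j); rewrite asboolT.
pose k (i : 'I_n) : 'I_n + E :=
  if pselect (g i \in E) is left p then inr (exist _ (g i) p) else inl (r i).
exists (Exs (formula_map k psi)) => S e; rewrite sat_Exs.
split=> [[b]|[e' e'E]]; last first.
  rewrite sat_map => h; exists (e' \o g); rewrite sat_map; congr sat: h.
  by apply: funext => i; rewrite /k /=; case: pselect => [p|_] /=; rewrite ?gr // -e'E.
rewrite sat_map => h; have [s0] := carrier_inhabited S.
pose e' v := if pselect (v \in E) is left p then e (exist _ v p) else
  if [pick j | `[< g j = v >]] is Some j then b (r j) else s0.
exists e' => [[x p]|].
  rewrite /e' /=; case: pselect => // q; congr e; exact: val_inj.
rewrite sat_map; congr sat: h; apply: funext => i; rewrite /e' /k /=.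
case: pselect => // _; case: pickP => [j /asboolP /rg -> //|/(_ i)].
by rewrite asboolT.
Qed.
End Syntax.

(** * Boolean-valued theories: compactness, witnesses and amalgamation *)

Section BooleanTheories.
Variables (d : Order.disp_t) (B : ctbDistrLatticeType d) (L : language).
Local Open Scope order_scope.

Record btheory (V : Type) (v : formula L V -> B) : Prop := BTheory {
  btheory_valid : forall phi, valid phi -> v phi = \top;
  btheory_not : forall phi, v (Not phi) = ~` v phi;
  btheory_and : forall phi psi, v (And phi psi) = v phi `&` v psi
}.

Lemma btheory_value (M : full_bstruct B L) : btheory (@value _ B L M).
Proof. by split; [exact: value_valid|exact: value_not|exact: value_and]. Qed.

Lemma btheory_map (V W : Type) (g : V -> W) (v : formula L W -> B) :
  btheory v -> btheory (v \o formula_map g).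
Proof.
by move=> [v1 vN vA]; split=> [phi /(valid_map g) /v1|phi|phi psi] //=;
  rewrite ?vN ?vA.
Qed.

Section BTheory.
Variables (V : Type) (v : formula L V -> B).
Hypothesis hv : btheory v.

Lemma btheory_le (phi psi : formula L V) : ent phi psi -> v phi <= v psi.
Proof.
move=> h; have := btheory_valid hv (phi := Not (And phi (Not psi))).
rewrite !(btheory_not hv) (btheory_and hv) (btheory_not hv) => h1.
rewrite -[v psi]complK -disj_leC -[_ `&` _]complK h1 ?compl1 //.
by move=> S e [/h].
Qed.

Lemma btheory_unsat (phi : formula L V) : unsat phi -> v phi = \bot.
Proof.
by move=> h; rewrite -[v phi]complK -(btheory_not hv) (btheory_valid hv) ?compl1.
Qed.

Lemma btheory_eq (phi psi : formula L V) :
  (forall (S : structure L) (e : V -> S), sat e phi <-> sat e psi) -> v phi = v psi.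
Proof. by move=> h; apply: le_anti; rewrite !btheory_le // => S e /h. Qed.

(** The inequality at [Not phi] is the reverse inequality at [phi]. Hence lower bounds alone can
    prescribe a theory. *)
Lemma btheory_ge_eq (w : formula L V -> B) :
  btheory w -> (forall phi, v phi <= w phi) -> v = w.
Proof.
move=> hw h; apply: funext => phi; apply: le_anti; rewrite h /=.
by rewrite -leC -(btheory_not hv) -(btheory_not hw).
Qed.

Lemma btheory_bigAnd (I : eqType) (s : seq I) (phi : I -> formula L V) :
  v (\big[And/Top L V]_(i <- s) phi i) = \meet_(i <- s) v (phi i).
Proof.
elim: s => [|i s IH]; first by rewrite !big_nil (btheory_valid hv) //; exact: valid_Top.
by rewrite !big_cons (btheory_and hv) IH.
Qed.
End BTheory.

(* A pair [(phi, b)] stands for the constraint [b <= v phi] on a theory [v]. *)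
Inductive derives (V : Type) (G : set (formula L V * B)) : formula L V -> B -> Prop :=
| derives_in phi b of G (phi, b) : derives G phi b
| derives_top : derives G (Top L V) \top
| derives_and phi b psi c of derives G phi b & derives G psi c :
    derives G (And phi psi) (b `&` c).

(** A necessary condition for a theory to satisfy all constraints, as an unsatisfiable formula has
    value bottom; [compactness] shows that it suffices. *)
Definition consistent (V : Type) (G : set (formula L V * B)) : Prop :=
  forall phi b, derives G phi b -> unsat phi -> b = \bot.

Lemma derives_sub (V : Type) (G H : set (formula L V * B)) phi b :
  (G `<=` H)%classic -> derives G phi b -> derives H phi b.
Proof.
move=> GH; elim=> {phi b} [phi b /GH|//|phi b psi c _ hb _ hc].
- exact: derives_in.
- exact: derives_top.
- exact: derives_and.
Qed.

(** Conjunction and meet are idempotent up to equivalence, so all uses of the new constraint merge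
    into at most one. *)
Lemma derives_add (V : Type) (G : set (formula L V * B)) chi c phi b :
  derives (G `|` [set (chi, c)])%classic phi b ->
  exists psi b', derives G psi b' /\
    ((ent psi phi /\ b <= b') \/ (ent (And psi chi) phi /\ b <= b' `&` c)).
Proof.
elim=> {phi b} [phi b [h|[-> ->]]||phi b phi' b' _ [psi [a [ha h]]] _ [psi' [a' [ha' h']]]].
- by exists phi, b; split; [exact: derives_in|left; split].
- exists (Top L V), \top; split; first exact: derives_top.
  by right; rewrite meet1x; split=> // S e [].
- by exists (Top L V), \top; split; [exact: derives_top|left; split].
exists (And psi psi'), (a `&` a'); split; first exact: derives_and.
case: h h' => [[h le] [[h' le']|[h' le']]|[h le] [[h' le']|[h' le']]]; [left|right|right|right].
- by split; [move=> S e [/h ? /h'] | exact: leI2].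
- split; last by rewrite -meetA; exact: leI2.
  by move=> S e [[/h ? ? ?]]; split=> //; exact: h'.
- split; last by rewrite meetAC; exact: leI2.
  by move=> S e [[? /h' ?] ?]; split=> //; exact: h.
- split; last by rewrite -[c]meetxx meetACA; exact: leI2.
  by move=> S e [[? ?] ?]; split; [exact: h|exact: h'].
Qed.

Lemma maximal_consistent (V : Type) (G : set (formula L V * B)) : consistent G ->
  exists H, [/\ (G `<=` H)%classic, consistent H &
    forall x, consistent (H `|` [set x])%classic -> H x].
Proof.
move=> cG.
have [F FP Ft|A [cA mA]] := @Zorn_bigcup _ (fun X => consistent (G `|` X)%classic).
  (* A derivation is finite, so it takes place over one member of the chain, or over [set0] if it
     uses only [G]. *)
  move=> phi b hd; have [X [cX dX]] : exists X, consistent (G `|` X)%classic /\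
      derives (G `|` X)%classic phi b; last exact: cX dX.
  suff [X [FX|->] dX] : exists2 X, F X \/ X = set0 & derives (G `|` X)%classic phi b.
    by exists X; split=> //; exact: FP.
    by exists set0; split=> //; rewrite setU0.
  elim: hd => {phi b} [phi b [h|[X FX h]]||phi b psi c _ [X FX h] _ [Y FY h']].
  - by exists set0; [right|apply: derives_in; left].
  - by exists X; [left|apply: derives_in; right].
  - by exists set0; [right|exact: derives_top].
  have [XY|YX] : (X `<=` Y)%classic \/ (Y `<=` X)%classic.
    by case: FX FY => [FX|->] [FY|->]; [exact: Ft|right; exact: sub0set|left; exact: sub0set|left].
    exists Y => //; apply: derives_and => //; apply: derives_sub h; exact: setUS.
  by exists X => //; apply: derives_and => //; apply: derives_sub h'; exact: setUS.
exists (G `|` A)%classic; split; [exact: subsetUl|by []|move=> x cx].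
right; apply: contrapT => nA; apply: (mA (A `|` [set x])%classic); last by rewrite setUA.
rewrite properEneq; split; last exact: subsetUl.
by apply/eqP => e; apply: nA; rewrite e; right.
Qed.

(* For [H] maximal consistent, the supremum of the lower bounds that [H] forces
   on [phi] can be added to [H] as a bound of [phi], and its complement as a
   bound of [Not phi]: this makes the supremum a homomorphism. *)
Lemma compactness (hB : complete_algebra B) (V : Type) (G : set (formula L V * B)) :
  consistent G -> exists2 v, btheory v & forall x, G x -> x.2 <= v x.1.
Proof.
move=> /maximal_consistent[H [GH cH mH]].
pose lower phi := [set b | exists psi, derives H psi b /\ ent psi phi]%classic.
have /choice[v hv] phi : exists b, supremums (lower phi) b by have [b] := hB (lower phi); exists b.
have v_ge phi psi b : derives H psi b -> ent psi phi -> b <= v phi.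
  by move=> h h'; have [ub _] := hv phi; apply: ub; exists psi.
have v_le phi c : (forall psi b, derives H psi b -> ent psi phi -> b <= c) -> v phi <= c.
  by move=> h; have [_] := hv phi; apply=> b [psi [h1 h2]]; exact: h h1 h2.
have HN phi : H (Not phi, ~` v phi).
  apply: mH => theta b /derives_add[psi [b' [hd [[h le]|[h le]]]]] hu.
    by apply/eqP; rewrite -lex0 (le_trans le) // (cH _ _ hd) // => S e /h /hu.
  apply/eqP; rewrite -lex0 (le_trans le) // -(meetxC (v phi)) leI2 //.
  by apply: v_ge hd _ => S e hp; apply: contrapT => hn; apply: (hu S e); apply: h.
(* If [And psi phi] is unsatisfiable, consistency makes [b'] disjoint from every lower bound [c]
   that [H] forces on [phi], hence from their supremum. *)
have HP phi : H (phi, v phi).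
  apply: mH => theta b /derives_add[psi [b' [hd [[h le]|[h le]]]]] hu.
    by apply/eqP; rewrite -lex0 (le_trans le) // (cH _ _ hd) // => S e /h /hu.
  apply/eqP; rewrite -lex0 (le_trans le) // lex0 disj_leC lexC.
  apply: v_le => chi c hc hchi; rewrite -disj_leC meetC; apply/eqP.
  apply: (cH _ _ (derives_and hd hc)) => S e [h1 /hchi h2].
  by apply: (hu S e); apply: h.
exists v; last by move=> [phi b] /GH h; apply: v_ge (derives_in h) _.
split=> [phi h|phi|phi psi].
- by apply: le_anti; rewrite lex1; apply: v_ge (derives_top _) _ => S e _; exact: h.
- apply: le_anti; rewrite (v_ge _ _ _ (derives_in (HN phi))) // andbT.
  rewrite -disj_leC; apply/eqP.
  by apply: (cH _ _ (derives_and (derives_in (HP _)) (derives_in (HP _)))) => S e [].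
- apply: le_anti; rewrite lexI.
  rewrite (v_ge _ _ _ (derives_and (derives_in (HP _)) (derives_in (HP _)))) // andbT.
  by apply/andP; split; apply: v_ge (derives_in (HP _)) _ => S e [].
Qed.

(* [D] need only be closed under conjunction up to entailment. *)
Lemma btheory_extend (hB : complete_algebra B) (V W : Type) (v : formula L V -> B)
    (j : V -> W) (D : set (formula L W * B)) :
  btheory v ->
  (exists theta, D (theta, \top)) ->
  (forall x y, D x -> D y -> exists2 z, D z &
     ent z.1 (And x.1 y.1) /\ x.2 `&` y.2 <= z.2) ->
  (forall psi x, D x -> unsat (And (formula_map j psi) x.1) -> v psi `&` x.2 = \bot) ->
  exists w, [/\ btheory w, w \o formula_map j = v & forall x, D x -> x.2 <= w x.1].
Proof.
move=> hv [t0 D0] DI cD.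
pose G : set (formula L W * B) := ((fun psi => (formula_map j psi, v psi)) @` setT `|` D)%classic.
have [|w hw Gw] := @compactness hB W G.
  move=> phi b hd hu.
  (* Every derivation reduces to one formula with its value under [v] and one constraint of [D]. *)
  have [psi [x [Dx ex le]]] : exists psi x,
      [/\ D x, ent (And (formula_map j psi) x.1) phi & b <= v psi `&` x.2].
    elim: hd {hu} => {phi b} [phi b [[psi _ [<- <-]]|Dphi]||
      phi b phi' b' _ [psi [x [Dx ex le]]] _ [psi' [y [Dy ey le']]]].
    - by exists psi, (t0, \top); rewrite meetx1; split=> // S e [].
    - exists (Top L V), (phi, b); split=> //; first by move=> S e [].
      by rewrite (btheory_valid hv) ?meet1x //; exact: valid_Top.
    - exists (Top L V), (t0, \top); split=> //; first by move=> S e [_ _]; exact: valid_Top.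
      by rewrite (btheory_valid hv) ?meet1x //; exact: valid_Top.
    have [z Dz [ez lez]] := DI _ _ Dx Dy.
    exists (And psi psi'), z; split=> //.
      by move=> S e [[? ?] /ez[? ?]]; split; [exact: ex|exact: ey].
    rewrite (btheory_and hv) (le_trans (leI2 le le')) // meetACA.
    exact: leI2.
  by apply/eqP; rewrite -lex0 (le_trans le) // (cD _ _ Dx) // => S e /ex /hu.
exists w; split=> // [|x Dx]; last by apply: Gw; right.
apply/esym/btheory_ge_eq => // [|psi]; first exact: btheory_map.
by apply: (Gw (_, _)); left; exists psi.
Qed.

(** The new variable [None] is subject to the Henkin axiom that [Ex phi] implies [phi]. Any
    assignment can be extended so as to satisfy it, with an arbitrary element if there is no
    witness. *)
Lemma btheory_witness (hB : complete_algebra B) (V : Type) (v : formula L V -> B)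
    (phi : formula L (option V)) : btheory v ->
  exists w, [/\ btheory w, w \o formula_map some = v & v (Ex phi) <= w phi].
Proof.
move=> hv; pose t := Not (And (formula_map some (Ex phi)) (Not phi)).
have [||psi x ->|w [hw wv /(_ (t, \top) erefl) wt]] :=
  @btheory_extend hB V (option V) v some [set (t, \top)] hv.
- by exists t.
- by move=> x y -> ->; exists (t, \top); rewrite //= meetxx.
- move=> hu; rewrite meetx1; apply: btheory_unsat => // S e hpsi.
  have [[a ha]|nex] := pselect (sat e (Ex phi)).
    apply: (hu S (oapp e a)) => /=; rewrite sat_map; split=> // -[_]; exact.
  have [a] := carrier_inhabited S; apply: (hu S (oapp e a)); split; first by rewrite sat_map.
  have hEx : sat (oapp e a) (formula_map some (Ex phi)) -> sat e (Ex phi).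
    by rewrite sat_map.
  by case=> /hEx.
exists w; split=> //; rewrite -wv /=.
apply: le_trans (_ : w (And (formula_map some (Ex phi)) t) <= _).
  by rewrite (btheory_and hw) -[X in X <= _]meetx1 leI2.
by apply: (btheory_le hw) => S e [h1 h2]; apply: contrapT => h3; exact: h2.
Qed.

(* A formula of [W] refuting one of [V] can be replaced by its projection to the
   common variables [E], where the two theories agree. *)
Lemma btheory_amalgam (hB : complete_algebra B) (V W X : Type)
    (v : formula L V -> B) (w : formula L W -> B) (E : set W) (f : E -> V)
    (i : V -> X) (j : W -> X) :
  btheory v -> btheory w ->
  (forall theta : formula L E, w (formula_map val theta) = v (formula_map f theta)) ->
  (forall (S : structure L) (e : V -> S) (e' : W -> S),
     (forall x : E, e' (val x) = e (f x)) ->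
     exists u : X -> S, u \o i = e /\ u \o j = e') ->
  exists u, [/\ btheory u, u \o formula_map i = v & u \o formula_map j = w].
Proof.
move=> hv hw hE hX.
have [||psi x [phi _ <-] /= hu|u [hu uv Du]] := @btheory_extend hB V X v i
  ((fun phi => (formula_map j phi, w phi)) @` setT)%classic hv.
- by exists (Top L X), (Top L W) => //; rewrite (btheory_valid hw) //; exact: valid_Top.
- move=> x y [phi _ <-] [psi _ <-] /=.
  exists (formula_map j (And phi psi), w (And phi psi)); first by exists (And phi psi).
  by rewrite (btheory_and hw); split.
- have [theta ht] := formula_project E phi.
  apply/eqP; rewrite -lex0; apply: le_trans (_ : v psi `&` w (formula_map val theta) <= _).
    apply: leI2 => //; apply: (btheory_le hw) => S e h.
    by rewrite sat_map; apply/ht; exists e.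
  rewrite hE -(btheory_and hv) lex0; apply/eqP/btheory_unsat => // S e h.
  have [h1] : sat e psi /\ sat e (formula_map f theta) := h.
  rewrite sat_map => /ht[e' e'f h2]; have [u [ui uj]] := hX S e e' e'f.
  by apply: (hu S u) => /=; rewrite !sat_map ui uj.
exists u; split=> //; apply/esym/btheory_ge_eq => // [|phi]; first exact: btheory_map.
by apply: (Du (_, _)); exists phi.
Qed.

End BooleanTheories.

(** * Saturated extensions *)

(** Taking the support of [Ex phi] keeps the variable [None] apart from the others. *)
Lemma formula_option_support (L : language) (V : Type) (phi : formula L (option V)) :
  exists n (g : 'I_n -> V) (psi : formula L (option 'I_n)), phi = formula_map (omap g) psi.
Proof.
have [n [g [[t u|r ts|psi|psi chi|psi] //= [->]]]] := formula_has_support (Ex phi).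
by exists n, g, psi.
Qed.

Definition over (L : language) (C : Type) (D : set C) (phi : formula L C) : Prop :=
  exists psi : formula L D, phi = formula_map val psi.

Lemma over_map (L : language) (C V : Type) (D : set C) (g : V -> C) (phi : formula L V) :
  (forall x, D (g x)) -> over D (formula_map g phi).
Proof.
move=> h; have gD x : g x \in D by rewrite inE.
exists (formula_map (fun x => exist _ (g x) (gD x)) phi).
by rewrite formula_map_comp.
Qed.

Lemma over_sub (L : language) (C : Type) (D D' : set C) (phi : formula L C) :
  D `<=` D' -> over D phi -> over D' phi.
Proof.
by move=> DD' [psi ->]; apply: over_map => x; apply/DD'/set_mem/valP.
Qed.

(* The constants of the saturated structure: [new w E f k] is the realization
   of the variable [k] in a copy of the theory [w], amalgamated along [f]
   over the variables in [E]. *)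
Inductive constant (B : Type) (L : language) (K V0 : Type) : Type :=
| base of V0
| new of (formula L K -> B) & set K & (K -> constant B L K V0) & K.
Arguments base {B L K V0}.
Arguments new {B L K V0}.

(** * A maximal theory over named constants *)

Section Saturation.
Variables (d : Order.disp_t) (B : ctbDistrLatticeType d) (hB : complete_algebra B).
Variables (L : language) (K V0 : Type) (hK : embeds nat K) (x0 : V0).
Variables (v0 : formula L V0 -> B) (hv0 : btheory v0).

Let C := constant B L K V0.

Definition realization (w : formula L K -> B) (E : set K) (f : K -> C) (k : K) : C :=
  if pselect (E k) then f k else new w E f k.

(* [val_of] is meaningful only on formulas over [dom]. *)
Record state := State { dom : set C; val_of : formula L C -> B }.

(** By the last clause a fresh name enters only together with the whole copy of the theory it
    belongs to. A copy that is missing therefore has no name in [dom], and can be adjoined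
    freely. *)
Record good (s : state) : Prop := Good {
  good_base : forall x, dom s (base x);
  good_base_val : forall phi, val_of s (formula_map base phi) = v0 phi;
  good_btheory : btheory (val_of s \o formula_map (val : dom s -> C));
  good_new : forall w E f k, dom s (new w E f k) ->
    (forall k, dom s (realization w E f k)) /\
    forall psi, val_of s (formula_map (realization w E f) psi) = w psi
}.

Definition extends (s t : state) : Prop :=
  dom s `<=` dom t /\ forall phi, over (dom s) phi -> val_of s phi = val_of t phi.

Lemma extends_refl s : extends s s.
Proof. by split. Qed.

Lemma extends_trans s t u : extends s t -> extends t u -> extends s u.
Proof.
move=> [st est] [tu etu]; split; first exact: subset_trans tu.
by move=> phi h; rewrite est // etu //; exact: over_sub h.
Qed.

Definition initial : state :=
  State (range base) (v0 \o formula_map (fun c => if c is base x then x else x0)).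

Lemma good_initial : good initial.
Proof.
split=> [x|phi||w E f k [] //]; first by exists x.
  by rewrite /= formula_map_comp formula_map_id.
by apply: (@btheory_map _ _ _ _ _ val (val_of initial)); exact: btheory_map.
Qed.

Section Chain.
Variables (A : set state) (a : state).
Hypotheses (Agood : forall s, A s -> good s) (Aa : A a).
Hypothesis Atot : forall s t, A s -> A t -> extends s t \/ extends t s.

Definition chain_dom : set C := \bigcup_(s in A) dom s.

(** Members of the chain agree on the formulas they share, so the choice of a member is immaterial;
    bottom is a filler for all other formulas. *)
Definition chain_val (phi : formula L C) : B :=
  if pselect (exists2 s, A s & over (dom s) phi) is left h
  then val_of (sval (cid2 h)) phi else \bot%O.

Lemma chain_valE s phi : A s -> over (dom s) phi -> chain_val phi = val_of s phi.
Proof.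
move=> As h; rewrite /chain_val; case: pselect => [p|[]]; last by exists s.
case: (cid2 p) => t /= At h'; case: (Atot As At) => -[_ e].
  by rewrite e.
by rewrite e.
Qed.

Lemma chain_fin n (g : 'I_n -> C) : (forall i, chain_dom (g i)) ->
  exists2 s, A s & forall i, dom s (g i).
Proof.
move=> h; suff [s As hs] : exists2 s, A s & forall i, i \in enum 'I_n -> dom s (g i).
  by exists s => // i; apply: hs; rewrite mem_enum.
elim: (enum _) => [|i l [s As IH]]; first by exists a.
have [t At ti] := h i; have [[st _]|[ts _]] := Atot As At.
  by exists t => // j; rewrite inE => /predU1P[->//|/IH /st].
by exists s => // j; rewrite inE => /predU1P[->|/IH //]; exact: ts.
Qed.

Lemma chain_over (phi : formula L C) : over chain_dom phi -> exists2 s, A s & over (dom s) phi.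
Proof.
move=> [psi ->]; have [n [g [chi ->]]] := formula_has_support psi.
rewrite formula_map_comp; have [i|s As h] := @chain_fin n (val \o g).
  exact/set_mem/valP.
by exists s => //; exact: over_map.
Qed.

Lemma good_chain : good (State chain_dom chain_val).
Proof.
split=> /= [x|phi||w E f k [s As hk]].
- by exists a => //; exact: good_base (Agood Aa) _.
- rewrite (chain_valE Aa) ?(good_base_val (Agood Aa)) //.
  by apply: over_map => x; exact: good_base (Agood Aa) _.
- have ov (phi : formula L chain_dom) : exists2 s, A s & over (dom s) (formula_map val phi).
    by apply: chain_over; exists phi.
  split=> [phi hphi|phi|phi psi] /=.
  + have [s As h] := ov phi; rewrite (chain_valE As) //.
    have := valid_map (val : chain_dom -> C) hphi; case: h => chi -> /(valid_map_inj val_inj).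
    exact: (btheory_valid (good_btheory (Agood As))).
  + have [s As [chi e]] := ov phi; rewrite e.
    rewrite !(chain_valE As); try by [exists chi|exists (Not chi)].
    exact: (btheory_not (good_btheory (Agood As)) chi).
  + have [s As [chi [theta [e e']]]] : exists2 s, A s & exists chi theta : formula L (dom s),
        formula_map val phi = formula_map val chi /\ formula_map val psi = formula_map val theta.
      have [s As hs] := ov phi; have [t At ht] := ov psi.
      have [[st _]|[ts _]] := Atot As At.
        by exists t => //; have [chi ->] := over_sub st hs; case: ht => theta ->; exists chi, theta.
      by exists s => //; have [chi ->] := over_sub ts ht; case: hs => theta ->; exists theta, chi.
    rewrite e e' !(chain_valE As); try by [exists chi|exists theta|exists (And chi theta)].
    exact: (btheory_and (good_btheory (Agood As)) chi theta).
- have [h1 h2] := good_new (Agood As) hk; split=> [k'|psi]; first by exists s.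
  by rewrite (chain_valE As) //; exact: over_map.
Qed.

Lemma extends_chain s : A s -> extends s (State chain_dom chain_val).
Proof. by move=> As; split=> [x sx|phi h] /=; [exists s|rewrite (chain_valE As)]. Qed.

End Chain.

(** [extends] is only a preorder, since [val_of] is arbitrary off [dom]; maximality is therefore
    stated as extension in both directions. *)
Lemma maximal_state : exists s, good s /\ forall t, good t -> extends s t -> extends t s.
Proof.
pose T := {s | good s}; pose R (s t : T) := `[< extends (sval s) (sval t) >].
have [] := @ZL_preorder T (exist _ _ good_initial) R.
- by move=> s; apply/asboolP; exact: extends_refl.
- by move=> s t u /asboolP h /asboolP h'; apply/asboolP; exact: extends_trans h'.
- move=> A Atot; have [[a Aa]|A0] := pselect (A !=set0); last first.
    by exists (exist _ _ good_initial) => s As; case: A0; exists s.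
  pose A' := [set s | exists2 t : T, A t & sval t = s].
  have g s : A' s -> good s by move=> [t _ <-]; exact: svalP.
  have Aa' : A' (sval a) by exists a.
  have Atot' s t : A' s -> A' t -> extends s t \/ extends t s.
    by move=> [s' As <-] [t' At <-]; case: (Atot _ _ As At) => /asboolP; [left|right].
  exists (exist _ _ (good_chain g Aa' Atot')) => s As; apply/asboolP.
  by apply: extends_chain => //; exists s.
move=> [s gs] ms; exists s; split=> // t gt st.
exact/asboolP/(ms (exist _ t gt))/asboolP.
Qed.

Section Maximal.
Variable s : state.
Hypotheses (gs : good s) (ms : forall t, good t -> extends s t -> extends t s).

(** If the copy of [w] along [f] had no name in [dom s], amalgamating it with the theory of [s] over
    [E] would extend [s] properly. *)
Lemma maximal_realizes (w : formula L K -> B) (E : set K) (f : K -> C) :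
  btheory w -> (forall k, E k -> dom s (f k)) ->
  (forall theta : formula L E,
     w (formula_map val theta) = val_of s (formula_map (f \o val) theta)) ->
  exists g : K -> C, [/\ forall k, dom s (g k),
    forall psi, val_of s (formula_map g psi) = w psi &
    forall k, E k -> g k = f k].
Proof.
move=> hw Ef wE; exists (realization w E f).
have rE k : E k -> realization w E f k = f k by rewrite /realization; case: pselect.
suff [k hk] : exists k, dom s (new w E f k).
  by have [? ?] := good_new gs hk; split.
(* Names of variables in [E] are adjoined too, although the realization avoids them: thus [D'] is
   strictly larger even if [E] is all of [K]. *)
apply: contrapT => nD; pose D' := dom s `|` range (new w E f).
have Dk k : D' (realization w E f k).
  rewrite /realization; case: pselect => h; first by left; exact: Ef.
  by right; exists k.
have fD (x : E) : f (val x) \in dom s by rewrite inE; exact/Ef/set_mem/valP.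
have iD (x : dom s) : val x \in D' by rewrite inE; left; exact/set_mem/valP.
have jD k : realization w E f k \in D' by rewrite inE.
pose fE (x : E) : dom s := exist (fun c => c \in dom s) _ (fD x).
pose iE (x : dom s) : D' := exist (fun c => c \in D') _ (iD x).
pose jE (k : K) : D' := exist (fun c => c \in D') _ (jD k).
have [|S e e' ee'|u [hu us uw]] := @btheory_amalgam _ B L hB (dom s) K D' _ w E
    fE iE jE (good_btheory gs) hw.
- by move=> theta; rewrite wE /= formula_map_comp.
- have [y0] := carrier_inhabited S.
  (* Joint assignment: old constants follow [e], and a fresh name takes the value of its index under
     [e']; [y0] is a filler. *)
  pose z (c : C) := if pselect (c \in dom s) is left p then e (exist _ c p) else
    if c is new _ _ _ k then e' k else y0.
  exists (z \o val); split; apply: funext => x; rewrite /z /=.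
    by case: pselect => [p|]; [congr e; exact: val_inj|case; exact: valP].
  have [Ex|nEx] := pselect (E x).
    have xE : x \in E by rewrite inE.
    have /= -> := ee' (exist (fun k => k \in E) x xE).
    rewrite rE //; case: pselect => [p|[]]; first by congr e; exact: val_inj.
    by rewrite inE; exact: Ef.
  have -> : realization w E f x = new w E f x by rewrite /realization; case: pselect.
  by case: pselect => // p; case: nD; exists x; exact: set_mem.
have bD : base x0 \in D' by rewrite inE; left; exact: good_base gs _.
pose r (c : C) : D' := if pselect (c \in D') is left p then exist (fun c => c \in D') c p
  else exist (fun c => c \in D') _ bD.
have rK : cancel val r.
  by move=> x; rewrite /r; case: pselect => [p|[]]; [exact: val_inj|exact: valP].
pose t := State D' (u \o formula_map r).
have uE (V : Type) (g : V -> D') phi : val_of t (formula_map (val \o g) phi) = u (formula_map g phi).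
  rewrite /= formula_map_comp; congr u; congr formula_map.
  by apply: funext => x /=; rewrite rK.
have st : extends s t.
  split=> [c|phi [psi ->]]; first by left.
  by rewrite (uE _ iE) -[RHS]/((u \o formula_map iE) psi) us.
have wt psi : val_of t (formula_map (realization w E f) psi) = w psi.
  by have := uE _ jE psi; rewrite -[RHS]/((u \o formula_map jE) psi) uw.
have gt : good t.
  split=> [x|phi||w' E' f' k]; first by left; exact: good_base gs _.
  - rewrite -(good_base_val gs); apply/esym; case: st => _; apply.
    by apply: over_map; exact: good_base gs.
  - suff -> : val_of t \o formula_map val = u by [].
    by apply: funext => phi; rewrite /= formula_map_comp -[RHS](congr1 u (formula_map_id _));
      congr u; congr formula_map; apply: funext => x /=; rewrite rK.
  move=> [|[k' _ [<- <- <- _]]]; last by split.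
  move=> /(good_new gs)[h1 h2]; split=> [k''|psi]; first by left.
  by rewrite -h2; apply/esym; case: st => _; apply; exact: over_map.
have [c _] := hK; apply: nD; exists (c 0).
by have [+ _] := ms gt st; apply; right; exists (c 0).
Qed.

(** Names refer to theories on [K] only, so [w] is first carried to [K] along a retraction of [K]
    onto [W]. *)
Lemma maximal_realizes_small (W : Type) (w : formula L W -> B) (E : set W) (f : W -> C) :
  embeds W K -> W -> btheory w -> (forall x, E x -> dom s (f x)) ->
  (forall theta : formula L E,
     w (formula_map val theta) = val_of s (formula_map (f \o val) theta)) ->
  exists g : W -> C, [/\ forall x, dom s (g x),
    forall psi, val_of s (formula_map g psi) = w psi &
    forall x, E x -> g x = f x].
Proof.
move=> WK y0 hw Ef wE; have [q [r rK]] := embeds_retraction WK y0.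
have [||theta|g [gD gw gE]] := @maximal_realizes (w \o formula_map q) (q @^-1` E) (f \o q).
- exact: btheory_map.
- by move=> k /Ef.
- have qE (k : q @^-1` E) : q (val k) \in E by rewrite inE; have := valP k; rewrite inE.
  have := wE (formula_map (fun k => exist (fun x => x \in E) _ (qE k)) theta).
  by rewrite /= !formula_map_comp.
exists (g \o r); split=> [x|psi|x Ex] /=; first exact: gD.
  by rewrite -formula_map_comp gw /= formula_map_comp (_ : q \o r = id) ?formula_map_id //;
    apply: funext.
by rewrite gE /= rK.
Qed.

(** Only finitely many constants occur in [phi]. The theory of these with one added witness lives on
    a small type, so [s] realizes it. *)
Lemma maximal_henkin (phi : formula L (option (dom s))) :
  exists a : dom s, (val_of s (formula_map val (Ex phi)) <=
    val_of s (formula_map val (inst phi a)))%O.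
Proof.
have [n [g [psi ->]]] := formula_option_support phi.
have hv : btheory (val_of s \o formula_map (val : dom s -> C)) := good_btheory gs.
have [w [hw ws le]] := btheory_witness hB psi (btheory_map g hv).
pose E : set (option 'I_n) := [set x | isSome x].
have /choice[p hp] (x : E) : exists i, val x = Some i.
  by case: x => -[i|] /= h; [exists i|move: h; rewrite inE].
have [|||G [GD Gw GE]] := @maximal_realizes_small (option 'I_n) w E
    (oapp (val \o g) (base x0)) _ None hw.
- apply: embeds_option => //; exact: embeds_countable.
- by move=> [i|] // _ /=; exact/set_mem/valP.
- move=> theta; have -> : val = some \o p by apply: funext => x; rewrite hp.
  by rewrite -[in LHS]formula_map_comp -[LHS]/((w \o formula_map some) _) ws /= !formula_map_comp.
have aD : G None \in dom s by rewrite inE.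
pose a : dom s := exist (fun c => c \in dom s) _ aD.
exists a; apply: le_trans (_ : w psi <= _)%O; first exact: le.
rewrite -Gw /inst !formula_map_comp.
have -> // : formula_map G psi = formula_map (val \o (oapp id a \o omap g)) psi.
by congr formula_map; apply: funext => -[i|] //=; rewrite GE.
Qed.

End Maximal.
End Saturation.

(** * Full structures from theories with witnesses *)

Section HenkinStructure.
Variables (d : Order.disp_t) (B : ctbDistrLatticeType d) (L : language).
Variables (V : Type) (v : formula L V -> B) (hv : btheory v).
Local Open Scope order_scope.
Hypothesis henkin : forall phi, exists a, v (Ex phi) <= v (inst phi a).
Hypothesis separated : forall a b : V, a <> b -> v (Eq (Var a) (Var b)) < \top.

Lemma inst_le_Ex (phi : formula L (option V)) (a : V) : v (inst phi a) <= v (Ex phi).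
Proof. by apply: (btheory_le hv) => S e; rewrite sat_inst; exists (e a). Qed.

Lemma henkin_full (phi : formula L (option V)) : exists a, v (Ex phi) = v (inst phi a).
Proof.
by have [a ha] := henkin phi; exists a; apply: le_anti; rewrite ha inst_le_Ex.
Qed.

Lemma henkin_sup (phi : formula L (option V)) :
  supremums (range (fun a => v (inst phi a))) (v (Ex phi)).
Proof.
split=> [_ [a _ <-]|b hb]; first exact: inst_le_Ex.
by have [a ->] := henkin_full phi; apply: hb; exists a.
Qed.

Definition henkin_bstruct : full_bstruct B L :=
  FullBStruct (btheory_valid hv) (btheory_not hv) (btheory_and hv)
    henkin_sup separated henkin_full.
End HenkinStructure.

(** * Identifying constants whose equality has value one *)

Section Quotient.
Variables (d : Order.disp_t) (B : ctbDistrLatticeType d) (L : language).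
Variables (V : Type) (v : formula L V -> B) (hv : btheory v).
Local Open Scope order_scope.

(** The finitely many equalities that matter have a conjunction [t] of value one; under [t] the two
    formulas are equivalent. *)
Lemma btheory_congr (h : V -> V) (phi : formula L V) :
  (forall x, v (Eq (Var x) (Var (h x))) = \top) -> v (formula_map h phi) = v phi.
Proof.
move=> hE; have [n [g [psi ->]]] := formula_has_support phi.
pose t := \big[And/Top L V]_(i <- enum 'I_n) Eq (Var (g i)) (Var (h (g i))).
have vt : v t = \top by rewrite (btheory_bigAnd hv) big1.
rewrite formula_map_comp -[LHS]meet1x -[RHS]meet1x -vt -!(btheory_and hv).
have ge (S : structure L) (e : V -> S) : sat e t -> e \o g = e \o (h \o g).
  by move=> /sat_bigAnd ht; apply: funext => i; apply: ht; rewrite mem_enum.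
have aux (S : structure L) (e : V -> S) : sat e t ->
    sat e (formula_map (h \o g) psi) <-> sat e (formula_map g psi).
  by move=> /ge ee; rewrite !sat_map ee.
by apply: (btheory_eq hv) => S e; split=> -[ht hp]; split=> //; exact/(aux _ _ ht).
Qed.

Definition eqv (x y : V) : Prop := v (Eq (Var x) (Var y)) = \top.

Lemma eqv_refl x : eqv x x.
Proof. exact: (btheory_valid hv). Qed.

(** The Euclidean form gives symmetry as well, by reflexivity. *)
Lemma eqv_trans x y z : eqv x y -> eqv x z -> eqv y z.
Proof.
rewrite /eqv => xy xz; apply: le_anti; rewrite lex1 /= -(meetxx \top) -{1}xy -xz.
by rewrite -(btheory_and hv); apply: (btheory_le hv) => S e /= [<- <-].
Qed.

Definition quotient := {c : set V | exists x, c = eqv x}.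

Definition quot (x : V) : quotient := exist _ (eqv x) (ex_intro _ x erefl).

Definition repr (c : quotient) : V := sval (cid (svalP c)).

Lemma reprK c : quot (repr c) = c.
Proof.
by case: c => c hc; apply: eq_exist; rewrite /repr; case: cid => a /= ->.
Qed.

Lemma quotP x y : quot x = quot y <-> eqv x y.
Proof.
split=> [[xy]|xy]; first by rewrite xy; exact: eqv_refl.
apply: eq_exist; apply/predeqP => z; split; first exact: eqv_trans.
by apply: eqv_trans; apply: eqv_trans xy _; exact: eqv_refl.
Qed.

Lemma quot_val (W : Type) (g : W -> V) (phi : formula L W) :
  v (formula_map (repr \o (quot \o g)) phi) = v (formula_map g phi).
Proof.
rewrite -[RHS](@btheory_congr (repr \o quot)) ?formula_map_comp // => x.
by apply/quotP; rewrite /= reprK.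
Qed.

Hypothesis henkin : forall phi, exists a, v (Ex phi) <= v (inst phi a).

Lemma quotient_henkin (phi : formula L (option quotient)) :
  exists a, v (formula_map repr (Ex phi)) <= v (formula_map repr (inst phi a)).
Proof.
have [a ha] := henkin (formula_map (omap repr) phi); exists (quot a).
apply: le_trans ha _; rewrite /inst !formula_map_comp -quot_val.
suff -> : repr \o (quot \o (oapp id a \o omap repr)) = repr \o oapp id (quot a) by [].
by apply: funext => -[x|] //=; rewrite reprK.
Qed.

Lemma full_quotient : exists (N : full_bstruct B L) (p : V -> N),
  (forall phi, value (formula_map p phi) = v phi) /\ forall y, exists x, p x = y.
Proof.
have sep (a b : quotient) : a <> b -> (v \o formula_map repr) (Eq (Var a) (Var b)) < \top.
  move=> ab; rewrite lt_neqAle lex1 andbT; apply/eqP => e; apply: ab.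
  by rewrite -[a]reprK -[b]reprK; apply/quotP.
exists (henkin_bstruct (btheory_map repr hv) quotient_henkin sep), quot.
split=> [phi|y]; last by exists (repr y); exact: reprK.
by have := quot_val id phi; rewrite /= formula_map_comp formula_map_id.
Qed.
End Quotient.

(** [N] is the quotient of a maximal theory. Saturation is stated for theories [w] on small types,
    which need be neither full nor separated; [E] is the part already placed in [N]. *)
Lemma saturated_extension (d : Order.disp_t) (B : ctbDistrLatticeType d)
    (hB : complete_algebra B) (L : language) (K V : Type) (v : formula L V -> B) :
  embeds nat K -> V -> btheory v ->
  exists (N : full_bstruct B L) (h : V -> N),
    (forall phi, value (formula_map h phi) = v phi) /\
    forall (W : Type) (w : formula L W -> B) (E : set W) (f : E -> N),
      embeds W K -> W -> btheory w ->
      (forall theta, w (formula_map val theta) = value (formula_map f theta)) ->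
      exists2 g : W -> N, forall psi, value (formula_map g psi) = w psi &
        forall x : E, g (val x) = f x.
Proof.
move=> hK x0 hv; have [s [gs ms]] := maximal_state K x0 hv.
have hvs : btheory (val_of s \o formula_map val) := good_btheory gs.
have [N [p [pE p_surj]]] := full_quotient hvs (maximal_henkin hB hK x0 gs ms).
have bD x : base x \in dom s by rewrite inE; exact: (good_base gs).
exists N, (fun x => p (exist (fun c => c \in dom s) _ (bD x))); split=> [phi|].
  by rewrite -formula_map_comp pE /= formula_map_comp -(good_base_val gs).
move=> W w E f WK y0 hw wE; have [r rK] := choice p_surj.
pose f' x := if pselect (x \in E) is left q
  then val (r (f (exist (fun x => x \in E) x q))) else base x0.
have f'E (x : E) : f' (val x) = val (r (f x)).
  by rewrite /f'; case: pselect => [q|[]]; [congr (val (r (f _))); exact: val_inj|exact: valP].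
have [|theta|g [gD gw gE]] := maximal_realizes_small hB hK x0 gs ms (E := E) (f := f') WK y0 hw.
- by move=> x /mem_set Ex; rewrite (f'E (exist (fun x => x \in E) x Ex)); exact/set_mem/valP.
- have -> : f' \o val = val \o (r \o f) by apply: funext => x /=; rewrite f'E.
  rewrite wE; have := pE (formula_map (r \o f) theta); rewrite /= !formula_map_comp => <-.
  by congr (value (formula_map _ _)); apply: funext => x /=; rewrite rK.
have gD' x : g x \in dom s by rewrite inE.
exists (fun x => p (exist (fun c => c \in dom s) _ (gD' x))) => [psi|x].
  by rewrite -formula_map_comp pE /= formula_map_comp -gw.
rewrite -[RHS]rK; congr p; apply: val_inj => /=; rewrite gE ?f'E //.
exact/set_mem/valP.
Qed.

(** * Downward Loewenheim-Skolem *)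

Section LowenheimSkolem.
Variables (d : Order.disp_t) (B : ctbDistrLatticeType d) (L : language).
Variables (K : Type) (hK : embeds nat K) (M : full_bstruct B L) (a : K -> M).

Lemma lowenheim_skolem : exists (M0 : full_bstruct B L) (h : M0 -> M),
  [/\ elementary h, embeds M0 K & forall k, exists x, h x = a k].
Proof.
have hKK : embeds K K by exists id.
have [c0 _] := hK.
have [q [r rK]] := embeds_retraction
  (embeds_sum hK hKK (embeds_formula hK L (embeds_option hK hKK))) (inl (c0 0)).
have /choice[wit witE] (phi : formula L (option M)) := value_full phi.
(* [K] also enumerates the next stage: one part of the indices repeats the old elements, the rest
   adds a witness for each formula over them. *)
pose step (e : K -> M) (k : K) : M :=
  match q k with inl k' => e k' | inr phi => wit (formula_map (omap e) phi) end.
pose e n := iter n step a.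
have eS n k : exists k', e n.+1 k' = e n k by exists (r (inl k)); rewrite /= /step rK.
have e_le n m k : (n <= m)%N -> exists k', e m k' = e n k.
  move=> /subnK <-; elim: (m - n)%N => [|p [k' <-]]; first by exists k.
  exact: eS.
pose D : set M := range (fun z : nat * K => e z.1 z.2).
have wit_D (phi : formula L (option D)) : D (wit (formula_map (omap val) phi)).
  have [n [g [psi ->]]] := formula_option_support phi.
  have /choice[z zE] i : exists z : nat * K, e z.1 z.2 = val (g i).
    by have := valP (g i); rewrite inE => -[z _ <-]; exists z.
  (* The stages increase, so the finitely many parameters all occur at the latest of their
     stages. *)
  have /choice[k kE] i : exists k, e (\max_j (z j).1) k = val (g i).
    by rewrite -zE; apply: e_le; exact: (leq_bigmax i).
  exists ((\max_j (z j).1).+1, r (inr (formula_map (omap k) psi))) => //=.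
  rewrite /step rK; congr wit; rewrite !formula_map_comp; congr formula_map.
  by apply: funext => -[i|] //=; rewrite kE.
have hv := btheory_map (val : D -> M) (btheory_value M).
have henkin (phi : formula L (option D)) : exists x : D,
    ((@value _ _ _ M \o formula_map val) (Ex phi) <=
     (@value _ _ _ M \o formula_map val) (inst phi x))%O.
  exists (exist (fun x => x \in D) _ (mem_set (wit_D phi))).
  rewrite /= witE /inst !formula_map_comp le_eqVlt; apply/orP; left; apply/eqP.
  by congr (value (formula_map _ _)); apply: funext => -[].
have sep (x y : D) : x <> y ->
    ((@value _ _ _ M \o formula_map val) (Eq (Var x) (Var y)) < \top)%O.
  by move=> xy; apply: value_eq_lt1 => /val_inj.
exists (henkin_bstruct hv henkin sep), (val : D -> M); split=> // [|k].
  apply: embeds_range; exact: embeds_prod.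
have aD : a k \in D by rewrite inE; exists (0, k).
by exists (exist (fun x => x \in D) _ aD).
Qed.
End LowenheimSkolem.

(** * Types and multiplicative refinements *)

Section Types.
Variables (L : language) (K : Type) (hK : embeds nat K).
Variables (S : structure L) (hS : saturated K S).

Lemma finite_preimage (I : eqType) (X : Type) (f : I -> X) (q : set X) :
  finite_set q -> q `<=` range f ->
  exists s : seq I, forall x, q x -> exists2 i, i \in s & f i = x.
Proof.
(* [Peq] equips [X] with an equality test, so that a finite set becomes a list. *)
elim/Peq: X => X in f q *; move=> /finite_seqP[t ->].
elim: t => [|x t IH] h; first by exists [::].
have [s hs] : exists s : seq I, forall x, x \in t -> exists2 i, i \in s & f i = x.
  by apply: IH => y /= yt; apply: h; rewrite /= inE yt orbT.
have [i _ ix] : range f x by apply: h; rewrite /= inE eqxx.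
exists (i :: s) => y /=; rewrite inE => /predU1P[->|/hs[j js jy]].
  by exists i; rewrite // inE eqxx.
by exists j; rewrite // inE js orbT.
Qed.

Lemma saturated_indexed (P : Type) (I : eqType) (e : P -> S)
    (theta : I -> formula L (option P)) :
  embeds P K ->
  (forall s : seq I, exists b, forall i, i \in s -> sat (oapp e b) (theta i)) ->
  exists b, forall i, sat (oapp e b) (theta i).
Proof.
move=> PK fin; have eA x : e x \in range e by rewrite inE; exists x.
pose e' (x : P) : range e := exist (fun y => y \in range e) _ (eA x).
have satE b i : sat (oapp val b) (formula_map (omap e') (theta i)) = sat (oapp e b) (theta i).
  by rewrite sat_map; congr sat; apply: funext => -[].
have [|q qf qp|b hb] := hS (A := range e) _ (p := range (fun i => formula_map (omap e') (theta i))).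
- exact/embeds_set/embeds_range.
- have [s hs] := finite_preimage qf qp; have [b hb] := fin s.
  by exists b => phi /hs[i /hb ? <-]; rewrite satE.
by exists b => i; rewrite -satE; apply: hb; exists i.
Qed.

(** The first coordinate realizes the one-variable type saying that each finite part of the family
    is satisfiable in the remaining coordinates. It then serves as a parameter for the induction. *)
Lemma saturated_tuples (n : nat) (P : Type) (I : eqType) (e : P -> S)
    (psi : I -> formula L ('I_n + P)) :
  embeds P K ->
  (forall s : seq I, exists b : 'I_n -> S, forall i, i \in s ->
     sat (fun v => match v with inl j => b j | inr x => e x end) (psi i)) ->
  exists b : 'I_n -> S, forall i,
    sat (fun v => match v with inl j => b j | inr x => e x end) (psi i).
Proof.
elim: n P e psi => [|n IH] P e psi PK fin.
  have [b0 _] := fin [::]; exists b0 => i; have [b hb] := fin [:: i].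
  have -> : b0 = b by apply: funext => -[].
  by apply: hb; rewrite inE.
pose rho (v : 'I_n.+1 + P) : 'I_n + option P :=
  match v with inl j => if unlift ord0 j is Some j' then inl j' else inr None
             | inr x => inr (Some x) end.
pose cons (c : S) (b : 'I_n -> S) j := oapp b c (unlift ord0 j).
have satE c b i :
    sat (fun v => match v with inl j => b j | inr x => oapp e c x end) (formula_map rho (psi i)) =
    sat (fun v => match v with inl j => cons c b j | inr x => e x end) (psi i).
  rewrite sat_map; congr sat; apply: funext => -[j|x] //=; rewrite /cons /rho.
  by case: unlift.
have [ss|c hc] := @saturated_indexed P (seq I) e
  (fun s => Exs (\big[And/Top L _]_(i <- s) formula_map rho (psi i))) PK.
  (* A single tuple satisfying the union of the finite parts in [ss] serves all of them. *)
  have [b hb] := fin (flatten ss); exists (b ord0) => s sss.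
  rewrite sat_Exs; exists (b \o lift ord0); apply/sat_bigAnd => i si; rewrite satE.
  have -> : cons (b ord0) (b \o lift ord0) = b.
    by apply: funext => j; rewrite /cons; case: unliftP => [j' ->|->].
  by apply: hb; apply/flattenP; exists s.
have [||b hb] := IH (option P) (oapp e c) (fun i => formula_map rho (psi i)).
- exact: embeds_option.
- move=> s; have := hc s; rewrite sat_Exs => -[b /sat_bigAnd hb].
  by exists b.
by exists (cons c b) => i; rewrite -satE.
Qed.
End Types.

(** * From saturation to multiplicative refinements *)

Section Transfer.
Variables (d : Order.disp_t) (B : ctbDistrLatticeType d) (L : language).

Lemma bstruct_inhabited (M : full_bstruct B L) : inhabited M.
Proof. by have [a _] := value_full (Top L (option M)); constructor. Qed.

Lemma elementary_inj (M N : full_bstruct B L) (f : M -> N) : elementary f -> injective f.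
Proof.
move=> hf x y xy; apply: contrapT => /value_eq_lt1.
have e0 : value (Eq (Var (f y)) (Var (f y)) : formula L N) = \top%O by exact: value_valid.
by rewrite -hf /= xy e0 ltxx.
Qed.

Lemma elementary_bmodels (T : theory L) (M N : full_bstruct B L) (f : M -> N) :
  elementary f -> bmodels M T <-> bmodels N T.
Proof.
move=> hf; have E phi : formula_map (of_void N) phi = formula_map f (formula_map (of_void M) phi).
  by rewrite formula_map_comp; congr formula_map; apply: funext => -[].
by split=> h phi /h; rewrite E hf.
Qed.

(** The theory of [N0] is realized in [N] with the image of [M0] already placed, [f] being carried
    there along the inverse [r] of [i]. *)
Lemma saturated_elementary_extension (hB : complete_algebra B) (T : theory L)
    (K : Type) (M : full_bstruct B L) :
  embeds nat K -> bmodels M T ->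
  exists (N : full_bstruct B L) (h : M -> N), elementary h /\ bsaturated K T N.
Proof.
move=> hK MT; have [x0] := bstruct_inhabited M.
have [N [h [hE sN]]] := saturated_extension hB hK x0 (btheory_value M).
exists N, h; split=> //; split; first exact/(elementary_bmodels T (f := h)).
move=> M0 N0 i hi N0T /embeds_setT N0K f hf.
have /choice[r rE] (y : range i) : exists x, i x = val y.
  by have := valP y; rewrite inE => -[x _ <-]; exists x.
have [y0] := bstruct_inhabited N0.
have [|g gE gf] := sN N0 _ (range i) (f \o r) N0K y0 (btheory_value N0).
  move=> theta; have -> : val = i \o r by apply: funext => y; rewrite /= rE.
  by rewrite -(formula_map_comp r i) hi -(formula_map_comp r f) hf.
exists g; split=> // a.
have iR : i a \in range i by rewrite inE; exists a.
rewrite -[i a]/(val (exist (fun y => y \in range i) _ iR)) gf /=; congr f.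
by apply: (elementary_inj hi); rewrite rE.
Qed.

Section Meets.
Variable I : eqType.
Local Open Scope order_scope.

Lemma le_bigmeet (s : seq I) (F : I -> B) (x : B) :
  (forall i, i \in s -> x <= F i) <-> x <= \meet_(i <- s) F i.
Proof.
elim: s => [|i s IH]; first by rewrite big_nil lex1.
rewrite big_cons lexI; split=> [h|/andP[xi /IH h] j].
  by rewrite h ?inE ?eqxx //=; apply/IH => j js; rewrite h // inE js orbT.
by rewrite inE => /predU1P[->|/h].
Qed.

Lemma ultrafilter_bigmeet (U : set B) (s : seq I) (F : I -> B) :
  ultrafilter U -> (forall i, U (F i)) -> U (\meet_(i <- s) F i).
Proof.
move=> hU hF; elim: s => [|i s IH]; first by rewrite big_nil; exact: ultrafilter_top.
by rewrite big_cons; exact: ultrafilter_meet.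
Qed.
End Meets.

Variables (U : set B) (hU : ultrafilter U) (T : theory L).
Variables (K : choiceType) (hK : embeds nat K).
Hypothesis hB : complete_algebra B.

Lemma saturates_los (A : {fset K} -> B) :
  saturates K U T -> los_map T A -> dist_in U A -> has_mult_refinement U A.
Proof.
move=> satT [n [distA [m [phi [M [a [MT AE]]]]]]] AU.
have [N [h [hE bsN]]] := saturated_elementary_extension hB hK MT.
have [S [p [p_surj pE]]] := specialization_exists N hU.
have hS := satT _ bsN S p (conj p_surj pE).
pose conjunct (s : {fset K}) : formula L ('I_n + M) := \big[And/Top L ('I_n + M)]_(i <- s)
  formula_map (fun v => match v with inl x => inl x | inr y => inr (a i y) end) (phi i).
have hAE s : A s = value (formula_map h (Exs (conjunct s))) by rewrite hE AE.
pose P := {k : K & 'I_(m k)}.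
have PK : embeds P K.
  apply: embeds_trans (embeds_prod hK (ex_intro _ id (fun x y => id)) hK).
  exists (fun x : P => (tag x, val (tagged x))) => -[k x] [k' x'] /= [kk].
  by case: k' / kk x' => x' /val_inj ->.
have [s|b hb] := @saturated_tuples L K hK S hS n P K (fun x => p (h (a (tag x) (tagged x))))
  (fun k => formula_map (fun v => match v with
     inl x => inl x | inr y => inr (Tagged (fun k => 'I_(m k)) y) end) (phi k)) PK.
  (* Finite satisfiability: [A] at this finite set lies in [U], so the existential formula holds in
     the specialization. *)
  have := AU [fset x in s]%fset; rewrite hAE pE sat_map sat_Exs => -[b /sat_bigAnd hb].
  exists b => i si; have := hb i; rewrite !sat_map inE => /(_ si).
  by congr sat; apply: funext => -[].
have /choice[c cE] j : exists x : N, p x = b j by exact: p_surj.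
pose e k (v : 'I_n + 'I_(m k)) : N := match v with inl x => c x | inr y => h (a k y) end.
(* These values are taken at the lift [c] of the realizing tuple. Their meets refine [A] because [c]
   is a possible witness for the existential formula with value [A s]. *)
pose D k := value (formula_map (e k) (phi k)).
have DU k : U (D k).
  rewrite pE sat_map; have := hb k; rewrite sat_map; congr sat.
  by apply: funext => -[j|y] //=; rewrite cE.
exists (fun s => \meet_(k <- s) D k)%O; split.
- split=> [s e0||s t /fsubsetP st].
  + by apply: (ultrafilter_bot hU); rewrite -e0; exact: ultrafilter_bigmeet.
  + by rewrite big_seq_fset0.
  + apply/le_bigmeet => k /st kt.
    by have /le_bigmeet := lexx (\meet_(k <- t) D k)%O; apply.
- by move=> s; exact: ultrafilter_bigmeet.
- by move=> s; apply: eq_bigr => k _; rewrite big_seq_fset1.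
move=> s; rewrite hAE -(btheory_bigAnd (btheory_value N)).
apply: (btheory_le (btheory_value N)) => S' e' /sat_bigAnd hs.
rewrite sat_map sat_Exs; exists (e' \o c); apply/sat_bigAnd => k ks.
have := hs k ks; rewrite !sat_map; congr sat.
by apply: funext => -[].
Qed.

(** With no variable to quantify, the value of a conjunction is the meet of the values, so [A]
    refines itself. *)
Lemma los_length0 (A : {fset K} -> B) :
  los_map_of_length T A 0 -> dist_in U A -> has_mult_refinement U A.
Proof.
move=> [distA [m [phi [M [a [MT AE]]]]]] AU; exists A; split=> //.
pose D i := value (Exs (formula_map (fun v => match v with
  | inl x => inl x | inr y => inr (a i y) end) (phi i))).
have AD s : A s = (\meet_(i <- s) D i)%O.
  rewrite AE -(btheory_bigAnd (btheory_value M)).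
  apply: (btheory_eq (btheory_value M)) => S e.
  rewrite sat_map; split=> [/sat_bigAnd h|/sat_bigAnd h]; apply/sat_bigAnd => i /h.
    by rewrite -(sat_map (@unbind_nil M) e).
  by rewrite -(sat_map (@unbind_nil M) e).
by move=> s; rewrite AD; apply: eq_bigr => i _; rewrite AD big_seq_fset1.
Qed.
End Transfer.

(** * From multiplicative refinements to saturation *)

Section Realization.
Variables (d : Order.disp_t) (B : ctbDistrLatticeType d) (hB : complete_algebra B).
Variables (L : language) (T : theory L) (K : choiceType) (hK : embeds nat K).
Local Open Scope order_scope.

(** This is where multiplicativity enters: it closes the constraints with bounds [A s] under
    conjunction, as [btheory_extend] requires. *)
Lemma multiplicative_meet (A : {fset K} -> B) (s t : {fset K}) :
  distribution A -> multiplicative A -> A s `&` A t <= A (s `|` t)%fset.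
Proof.
move=> distA multA; rewrite [leRHS]multA; apply/le_bigmeet => k.
rewrite in_fsetU => /orP[ks|kt].
  by apply: le_trans (leIl _ _) _; apply: distribution_decr distA _ _ _; rewrite fsub1set.
by apply: le_trans (leIr _ _) _; apply: distribution_decr distA _ _ _; rewrite fsub1set.
Qed.

Lemma bsaturated_realizes (M : full_bstruct B L) (X : Type) (c : X -> M)
    (eta : K -> formula L (option X)) (A : {fset K} -> B) :
  bsaturated K T M -> embeds X K -> distribution A -> multiplicative A ->
  (forall s : {fset K}, A s <= value (Ex (\big[And/Top L (option M)]_(k <- s)
     formula_map (omap c) (eta k)))) ->
  exists b : M, forall k, A [fset k]%fset <= value (formula_map (oapp c b) (eta k)).
Proof.
move=> [MT satM] XK distA multA hA.
have hKX := embeds_option hK XK.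
have [y0] := bstruct_inhabited M.
(* [X] may be empty, hence the spare point [None], sent to [y0]. [M0] is a small elementary
   substructure containing all parameters [c x]. *)
have [q [r rK]] := embeds_retraction hKX None.
have [M0 [h0 [h0E M0K h0a]]] := lowenheim_skolem hK (oapp c y0 \o q).
have /choice[c0 c0E] x : exists y, h0 y = c x.
  by have [y hy] := h0a (r (Some x)); exists y; rewrite hy /= rK.
have [x0] := bstruct_inhabited M0.
have hv := btheory_value M0.
pose conjunct (s : {fset K}) := \big[And/Top L (option M0)]_(k <- s)
  formula_map (omap c0) (eta k).
have conjE s : value (Ex (conjunct s)) = value (Ex (\big[And/Top L (option M)]_(k <- s)
     formula_map (omap c) (eta k))).
  rewrite -h0E; apply: (btheory_eq (btheory_value M)) => S e.
  rewrite sat_map /=; split=> -[y /sat_bigAnd hy]; exists y; apply/sat_bigAnd => k /hy;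
    rewrite !sat_map; congr sat; by apply: funext => -[x|] //=; rewrite c0E.
(* The theory of [M0] is extended by a variable [None] meeting all constraints; by [hA] the bound
   [A s] lies below the value of the existential formula, which gives consistency. *)
have [||psi x [s _ <-] /= hu|w [hw ws Aw]] := @btheory_extend _ B L hB M0 (option M0) _ some
    (range (fun s => (conjunct s, A s))) hv.
- by exists (conjunct fset0), fset0 => //; rewrite (distribution_fset0 distA).
- move=> x y [s _ <-] [t _ <-]; exists (conjunct (s `|` t)%fset, A (s `|` t)%fset).
    by exists (s `|` t)%fset.
  split; last exact: multiplicative_meet.
  move=> S e /sat_bigAnd h; split; apply/sat_bigAnd => k ks; apply: h;
    by rewrite in_fsetU ks ?orbT.
- apply/eqP; rewrite -lex0; apply: le_trans (_ : value psi `&` value (Ex (conjunct s)) <= _).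
    by rewrite leI2 // conjE.
  rewrite -value_and lex0; apply/eqP/(btheory_unsat hv) => S e h.
  have [h1 [y h2]] : sat e psi /\ sat e (Ex (conjunct s)) := h.
  by apply: (hu S (oapp e y)); split=> //; rewrite sat_map.
(* [N] realizes [w] in a full structure. Its small elementary substructure [N0] still contains
   [option M0], so saturation of [M] embeds [N0] over [M0], and [b] is the image of [None]. *)
have [N [h [hE _]]] := saturated_extension hB hK (None : option M0) hw.
have [q' [r' rK']] := embeds_retraction (embeds_option hK M0K) None.
have [N0 [h1 [h1E N0K h1a]]] := lowenheim_skolem hK (h \o q').
have /choice[j jE] x : exists y, h1 y = h x.
  by have [y hy] := h1a (r' x); exists y; rewrite hy /= rK'.
have jw phi : value (formula_map j phi) = w phi.
  rewrite -hE -h1E formula_map_comp; congr (value (formula_map _ _)).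
  by apply: funext => x /=; rewrite jE.
have iE : elementary (j \o some) by move=> phi; rewrite -formula_map_comp jw -ws.
have N0T : bmodels N0 T by apply/(elementary_bmodels T iE)/(elementary_bmodels T h0E).
have [g [gE gi]] := satM M0 N0 _ iE N0T (iffRL (embeds_setT _ _) N0K) h0 h0E.
exists (g (j None)) => k.
have -> : formula_map (oapp c (g (j None))) (eta k) =
    formula_map g (formula_map j (formula_map (omap c0) (eta k))).
  rewrite !formula_map_comp; congr formula_map.
  by apply: funext => -[x|] //=; rewrite gi c0E.
rewrite gE jw; apply: le_trans (_ : w (conjunct [fset k]%fset) <= _).
  by apply: (Aw (_, _)); exists [fset k]%fset.
by apply: (btheory_le hw) => S e /sat_bigAnd; apply; rewrite inE.
Qed.

Variables (U : set B) (hU : ultrafilter U).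

(** Length 1 is assumed rather than arity 1, because the map built from a type might also be
    presented with length 0. *)
Lemma los_saturates :
  (forall A : {fset K} -> B, los_map_of_length T A 1 -> dist_in U A ->
     has_mult_refinement U A) ->
  saturates K U T.
Proof.
move=> losT M satM S pi [pi_surj piE] A AK p fin.
have [s0] := carrier_inhabited S.
have [[phi0 p0]|pN] := pselect (p !=set0); last by exists s0 => phi pphi; case: pN; exists phi.
have AK' : embeds A K by apply/embeds_set.
have [q [r rK]] := embeds_retraction (embeds_formula hK L (embeds_option hK AK')) phi0.
(* [K] enumerates all formulas over [A]; those outside [p] are replaced by [phi0], so that [eta]
   enumerates exactly [p]. *)
pose eta k := if pselect (p (q k)) then q k else phi0.
have eta_p k : p (eta k) by rewrite /eta; case: pselect.
have etaE phi : p phi -> eta (r phi) = phi by rewrite /eta rK; case: pselect.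
have /choice[c cE] (x : A) : exists y, pi y = val x by exact: pi_surj.
have supp k : exists z : {n & (('I_n -> A) * formula L (option 'I_n))%type},
    eta k = formula_map (omap (tagged z).1) (tagged z).2.
  have [n [g [psi ->]]] := formula_option_support (eta k).
  by exists (Tagged (fun n => (('I_n -> A) * formula L (option 'I_n))%type) (g, psi)).
have [z zE] := choice supp.
pose m k := tag (z k).
pose phi k : formula L ('I_1 + 'I_(m k)) :=
  formula_map (fun o => if o is Some j then inr j else inl ord0) (tagged (z k)).2.
pose a k (j : 'I_(m k)) : M := c ((tagged (z k)).1 j).
pose chi (s : {fset K}) : formula L M := Exs (\big[And/Top L ('I_1 + M)]_(i <- s)
  formula_map (fun v => match v with inl x => inl x | inr y => inr (a i y) end) (phi i)).
have chiE s (S' : structure L) (e : M -> S') : sat e (chi s) <->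
    exists b, forall k, k \in s -> sat (oapp (e \o c) b) (eta k).
  rewrite sat_Exs; split=> [[b /sat_bigAnd hb]|[b hb]].
    exists (b ord0) => k ks; have := hb k ks; rewrite !sat_map zE sat_map; congr sat.
    by apply: funext => -[].
  exists (fun=> b); apply/sat_bigAnd => k ks; have := hb k ks.
  by rewrite zE !sat_map; congr sat; apply: funext => -[].
(* Finite satisfiability of [p] in the specialization puts the Los map of the lifted parameters in
   [U]. *)
have chiU s : U (value (chi s)).
  apply/piE/chiE; have [||b hb] := fin [set eta k | k in [set` s]].
  - exact/finite_image/finite_fset.
  - by move=> _ [k _ <-].
  exists b => k ks; have -> : pi \o c = val by apply: funext => x; rewrite /= cE.
  by apply: hb; exists k.
have los : los_map_of_length T (fun s => value (chi s)) 1.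
  split; last by exists m, phi, M, a; split; [exact: satM.1|].
  split=> [s e0||s t /fsubsetP st].
  - by apply: (ultrafilter_bot hU); rewrite -e0.
  - apply: value_valid => S' e; apply/chiE.
    by have [x] := carrier_inhabited S'; exists x => k; rewrite inE.
  - apply: (btheory_le (btheory_value M)) => S' e /chiE[b hb]; apply/chiE.
    by exists b => k /st; exact: hb.
have [A' [distA' A'U multA' refA']] := losT _ los chiU.
have [s|b hb] := bsaturated_realizes (c := c) (eta := eta) satM AK' distA' multA'.
  apply: le_trans (refA' s) _; apply: (btheory_le (btheory_value M)) => S' e /chiE[b hb].
  exists b; apply/sat_bigAnd => k /hb; rewrite sat_map; congr sat.
  by apply: funext => -[].
exists (pi b) => psi /etaE <-.
have /piE := ultrafilter_up hU (hb (r psi)) (A'U _); rewrite sat_map; congr sat.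
by apply: funext => -[x|] //=; rewrite cE.
Qed.
End Realization.

(** * Equivalence of the three conditions *)

Theorem theorem4p9 (d : Order.disp_t) (B : ctbDistrLatticeType d)
    (hB : complete_algebra B) (U : set B) (hU : ultrafilter U)
    (L : language) (T : theory L) (hT : complete_theory T)
    (K : choiceType) (hK : infinite_set [set: K]%classic) :
  (saturates K U T <->
    (forall A : {fset K} -> B, los_map T A -> dist_in U A ->
       has_mult_refinement U A)) /\
  ((forall A : {fset K} -> B, los_map T A -> dist_in U A ->
       has_mult_refinement U A) <->
   (forall A : {fset K} -> B, los_arity T A 1 -> dist_in U A ->
       has_mult_refinement U A)).
Proof.
have nK : embeds nat K by apply/embeds_setT/infiniteP.
have AB : saturates K U T -> forall A : {fset K} -> B, los_map T A -> dist_in U A ->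
    has_mult_refinement U A.
  by move=> satT A; exact: saturates_los.
have BC : (forall A : {fset K} -> B, los_map T A -> dist_in U A ->
       has_mult_refinement U A) -> forall A : {fset K} -> B, los_arity T A 1 -> dist_in U A ->
    has_mult_refinement U A.
  by move=> losT A [los1 _]; apply: losT; exists 1.
have CA : (forall A : {fset K} -> B, los_arity T A 1 -> dist_in U A ->
    has_mult_refinement U A) -> saturates K U T.
  move=> losT; apply: los_saturates => // A los1 AU.
  (* A map of length 1 has arity 1 unless it also has length 0. *)
  have [los0|nlos0] := pselect (los_map_of_length T A 0); first exact: los_length0 los0 AU.
  by apply: losT => //; split=> // -[|k].
split; split=> h; [exact: AB|exact/CA/BC|exact: BC|exact/AB/CA].
Qed.
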